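(* Let $V$ be a Banach space with norm $\|\cdot\|_V$, $K\subset V$ a compact convex subset, and $(X,\mathbb{Z}^k,T)$ a dynamical system with the marker property. Then for a dense $G_\delta$ subset of $f\in C(X,K)$, \[\mathrm{mdim}_M(I_f(X),D)\le\mathrm{mdim}(X).\]
   Context: $C(X,K)$ has the metric $\|f-g\|=\sup_x\|f(x)-g(x)\|_V$. $I_f(x)=(f(T^nx))_{n\in\mathbb{Z}^k}\in K^{\mathbb{Z}^k}$; $I_f(X)$ is a closed subsystem of the shift $\sigma^n((x_m)_m)=(x_{m+n})_m$ on $K^{\mathbb{Z}^k}$, with metric $D(x,y)=\sum_{n\in\mathbb{Z}^k}2^{-|n|}\|x_n-y_n\|_V$ ($|\cdot|$ Euclidean). For a system $(Y,\mathbb{Z}^k)$ with metric $\rho$: $\rho_\Omega(x,y)=\sup_{n\in\Omega}\rho(T^nx,T^ny)$, $[N]=\{0,\dots,N-1\}^k$, $A(Y,\varepsilon,\rho)$ is the minimal cardinality of an open cover by sets of $\rho$-diameter $<\varepsilon$, $S(Y,\varepsilon,\rho)=\lim_{N}N^{-k}\log A(Y,\varepsilon,\rho_{[N]})$, $\mathrm{mdim}_M(Y,\rho)=\liminf_{\varepsilon\to0}S(Y,\varepsilon,\rho)/|\log\varepsilon|$. Mean dimension: $\mathrm{widim}_\varepsilon(X,d)$ is the minimal dimension of a finite simplicial complex admitting a continuous map with fibers of $d$-diameter $<\varepsilon$, $\mathrm{mdim}(X)=\lim_{\varepsilon\to0}\lim_NN^{-k}\mathrm{widim}_\varepsilon(X,d_{[N]})$.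 Marker property: for every finite $F\subset\mathbb{Z}^k$ there is an open $U$ with $X=\bigcup_nT^nU$ and $U\cap T^nU=\emptyset$ for nonzero $n\in F$. *)

(* Defs.v *)
From HB Require Import structures.
From mathcomp Require Import all_boot all_order all_algebra.
From mathcomp Require Import all_classical all_reals all_analysis.
Set Implicit Arguments. Unset Strict Implicit. Unset Printing Implicit Defensive.
Import Order.TTheory GRing.Theory Num.Theory.
Import numFieldNormedType.Exports.
Local Open Scope classical_set_scope.
Local Open Scope ring_scope.

(* The group Z^k is represented by integer row vectors 'rV[int]_k;
   the i-th coordinate of n is  n ord0 i. *)

Definition zknorm {R : realType} {k : nat} (n : 'rV[int]_k) : R :=
  Num.sqrt (\sum_(i < k) ((n ord0 i)%:~R) ^+ 2).

Definition is_Zk_action {k : nat} {X : topologicalType}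
    (T : 'rV[int]_k -> X -> X) : Prop :=
  (forall x, T 0 x = x) /\
  (forall m n x, T (m + n) x = T m (T n x)) /\
  (forall n, continuous (T n)).

Definition zbox (k N : nat) : set 'rV[int]_k :=
  [set n | forall i : 'I_k, (0 <= n ord0 i)%R /\ (n ord0 i < N%:Z)%R].
Arguments zbox k N : clear implicits.

Definition dyn_dist {R : realType} {k : nat} {Y : Type}
    (T : 'rV[int]_k -> Y -> Y) (rho : Y -> Y -> R) (Om : set 'rV[int]_k)
    (x y : Y) : R :=
  sup [set rho (T n x) (T n y) | n in Om].

(* rho-diameter of a set (in extended reals; -oo for the empty set). *)
Definition ediam {R : realType} {Y : Type} (rho : Y -> Y -> R) (A : set Y)
  : \bar R :=
  ereal_sup [set (rho p.1 p.2)%:E | p in A `*` A].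

Definition rho_open {R : realType} {Y : Type} (rho : Y -> Y -> R)
    (Ysp U : set Y) : Prop :=
  U `<=` Ysp /\
  forall y, U y -> exists2 r : R, 0 < r & [set z | Ysp z /\ rho y z < r] `<=` U.

Definition cover_num {R : realType} {Y : Type} (Ysp : set Y)
    (eps : R) (rho : Y -> Y -> R) : R :=
  inf [set (n%:R : R) | n in [set n : nat | exists U : 'I_n -> set Y,
        (forall i, rho_open rho Ysp (U i) /\ (ediam rho (U i) < eps%:E)%E) /\
        Ysp `<=` \bigcup_i U i]].

Definition S_entropy {R : realType} {k : nat} {Y : Type}
    (T : 'rV[int]_k -> Y -> Y) (Ysp : set Y) (eps : R) (rho : Y -> Y -> R)
  : \bar R :=
  limn (fun N : nat =>
    ((ln (cover_num Ysp eps (dyn_dist T rho (zbox k N)))) / ((N ^ k)%N)%:R)%:E).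

Definition metric_mdim {R : realType} {k : nat} {Y : Type}
    (T : 'rV[int]_k -> Y -> Y) (Ysp : set Y) (rho : Y -> Y -> R) : \bar R :=
  ereal_sup [set ereal_inf [set (S_entropy T Ysp eps rho * (`|ln eps|^-1)%:E)%E
                           | eps in [set e : R | 0 < e < delta]]
            | delta in [set d : R | 0 < d]].

(* Finite simplicial complexes: an abstract simplicial complex on the finite
   vertex set 'I_m (a family of nonempty vertex sets closed under nonempty
   subsets) together with its standard geometric realization in R^m. *)
Definition is_simplicial_complex (m : nat) (S : {set {set 'I_m}}) : Prop :=
  (forall s : {set 'I_m}, s \in S -> (0 < #|s|)%N) /\
  forall s t : {set 'I_m}, s \in S -> t \subset s -> (0 < #|t|)%N -> t \in S.

Definition realization {R : realType} (m : nat) (S : {set {set 'I_m}})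
  : set 'rV[R]_m :=
  [set t | (forall i, 0 <= t ord0 i) /\ \sum_(i < m) t ord0 i = 1 /\
           [set i : 'I_m | t ord0 i != 0]%SET \in S].

Definition complex_dim (m : nat) (S : {set {set 'I_m}}) : nat :=
  \max_(s in S) #|s|.-1.

Definition widim {R : realType} {X : topologicalType} (eps : R)
    (rho : X -> X -> R) : R :=
  inf [set r : R | exists (m : nat) (S : {set {set 'I_m}}) (pi : X -> 'rV[R]_m),
         [/\ is_simplicial_complex S, continuous pi,
             (forall x, realization S (pi x)),
             (forall p, (ediam rho (pi @^-1` [set p]) < eps%:E)%E) &
             r = (complex_dim S)%:R]].

Definition mean_dim {R : realType} {k : nat} (X : metricType R)
    (T : 'rV[int]_k -> X -> X) : \bar R :=
  lim ((fun eps : R =>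
         limn (fun N : nat =>
           (widim eps (dyn_dist T (@mdist R X) (zbox k N)) / ((N ^ k)%N)%:R)%:E))
       @ 0^'+).

Definition marker_property {k : nat} {X : topologicalType}
    (T : 'rV[int]_k -> X -> X) : Prop :=
  forall F : set 'rV[int]_k, finite_set F ->
    exists U : set X, open U /\
      \bigcup_(n in [set: 'rV[int]_k]) (T n @` U) = [set: X] /\
      forall n, F n -> n != 0 -> U `&` (T n @` U) = set0.

Definition zshift {k : nat} {V : Type} (n : 'rV[int]_k)
    (x : 'rV[int]_k -> V) : 'rV[int]_k -> V :=
  fun m => x (m + n).

Definition Dshift {R : realType} {k : nat} {V : normedModType R}
    (x y : 'rV[int]_k -> V) : R :=
  fine (\esum_(n in [set: 'rV[int]_k]) ((2 `^ (- zknorm n)) * `|x n - y n|)%:E).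

Definition Imap {k : nat} {X V : Type} (T : 'rV[int]_k -> X -> X)
    (f : X -> V) (x : X) : 'rV[int]_k -> V :=
  fun n => f (T n x).

Definition CXK {X : topologicalType} {R : realType} {V : normedModType R}
    (K : set V) : set (X -> V) :=
  [set f | continuous f /\ forall x, K (f x)].

Definition sup_dist {X : Type} {R : realType} {V : normedModType R}
    (f g : X -> V) : R :=
  sup [set `|f x - g x| | x in [set: X]].

Definition dense_Gdelta_in {X : topologicalType} {R : realType}
    {V : normedModType R} (K : set V) (G : set (X -> V)) : Prop :=
  G `<=` CXK K /\
  (exists U : nat -> set (X -> V),
     (forall j, rho_open (@sup_dist X R V) (CXK K) (U j)) /\
     G = \bigcap_j U j) /\
  (forall f, CXK K f -> forall e : R, 0 < e ->
     exists2 g, G g & sup_dist f g < e).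

Definition convex_subset {R : realType} {V : normedModType R} (K : set V) : Prop :=
  forall x y t, K x -> K y -> 0 <= t <= 1 -> K (t *: x + (1 - t) *: y).

(* Main.v *)
(* Call f good at level j if at some scale eps < 1/j some window [N] needs fewer than
   exp((mdim + 1/j) N^k |log eps|) sets. Being good at level j is an open condition and, since
   windows can be tiled, it bounds S(eps)/|log eps|; so by Baire it suffices to approximate a
   given f by good functions.
   Take an eta-embedding pi of (X, d_[L]) into a complex P with dim P < (mdim + small) L^k and a
   Lipschitz partition of unity on pi(X); it yields approximations F_p of f o T^p, p in [L], that
   factor through P. The marker property provides continuous weights lam_p, p in [L], such that
   along every orbit all but a small proportion of Z^k is covered by translates j + [L] on which
   lam_p(T^(j+p) x) = 1, and g(x) = sum_p lam_p(x) F_p(T^-p x) is close to f. On such a translate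
   g is determined by one point of P, while at the remaining sites g moves in a fixed
   finite-dimensional simplex, which contributes little.
   The weights come from power diagrams with centres the visits to the marker set. Contracting a
   cell towards its centre opens gaps between the cells, so counting lattice points shows that
   few sites are close to two cells. *)

Require Import Defs.
From HB Require Import structures.
From mathcomp Require Import all_boot all_order all_algebra.
From mathcomp Require Import all_classical all_reals all_analysis.
From mathcomp Require Import zify ring lra.
Import Order.TTheory GRing.Theory Num.Theory.
Import numFieldNormedType.Exports.
Set Implicit Arguments.
Unset Strict Implicit.
Unset Printing Implicit Defensive.
Local Open Scope classical_set_scope.
Local Open Scope ring_scope.

(** * Compactness and continuity *)

(** The order of the choices carries the proof. A site outside the clean boxes costs [D'] grid
    coordinates, where [D'] counts the vertices of the simplex; it depends on [L] and on the net
    behind the partition of unity, but not on the weights [lam]. So the admissible proportion [th]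
    of such sites can be fixed after [D'], and the weights are built only then. The combinatorial
    data (which boxes are clean, the supports of barycentric coordinates) cost an amount per site
    that does not depend on the scale, and become negligible against |log eps| once eps is small.
    The margin that [Dshift] requires around a window is known only after eps; a window large
    against it makes it harmless. The obstacle is continuity of the weights: a site close to two
    cells mixes two tilings and cannot be described by one point of the complex. No shape estimate
    for the cells is available, so such sites are bounded by a count. On the covering side, labels
    without any continuity suffice, because a strict gap between two scales leaves room to thicken
    their classes to open sets. *)

Lemma finite_subcover (X : topologicalType) (I : choiceType) (U : I -> set X) :
  compact [set: X] -> (forall i, open (U i)) -> (forall x, exists i, U i x) ->
  exists s : seq I, forall x, exists2 i, i \in s & U i x.
Proof.
move=> /compact_near_coveringP cX oU cU.
(* The filter of finite lists directed by inclusion: a property that holds near this filter holds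
   for some list, uniformly in [x]. *)
pose F := filter_from [set: seq I] (fun s => [set t : seq I | {subset s <= t}]).
have FF : Filter F.
  apply: filter_from_filter; first by exists [::].
  move=> s t _ _; exists (s ++ t) => // u stu; split => i ii; apply: stu;
  by rewrite mem_cat ii ?orbT.
have [x _|s _ sP] := cX (seq I) F (fun s x => exists2 i, i \in s & U i x) FF.
  have [i Uix] := cU x.
  exists (U i, [set t : seq I | {subset [:: i] <= t}]); first split.
  - by apply: open_nbhs_nbhs; split; [exact: oU|exact: Uix].
  - by exists [:: i].
  - by move=> [y t] [/= Uy ht]; exists i => //; apply: ht; rewrite mem_head.
by exists s => x; apply: (sP s).
Qed.

Lemma continuous_mdist (R : realType) (X : metricType R) :
  continuous (fun z : X * X => mdist z.1 z.2 : R).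
Proof.
move=> [x y]; apply/cvgrPdist_le => /= e e0.
exists (ball x (e/2), ball y (e/2)).
  by split; apply: nbhsx_ballx; rewrite divr_gt0.
move=> [x' y'] /= []; rewrite !ballEmdist /= => hx hy.
have h1 := metric_triangle x x' y; have h2 := metric_triangle x' y' y.
have h3 := metric_triangle x' x y'; have h4 := metric_triangle x y y'.
have := metric_sym x x'; have := metric_sym y y' => e1 e2.
rewrite ler_norml; apply/andP; split; lra.
Qed.

Lemma finite_net (R : realType) (X : topologicalType) (d : X -> X -> R) (r : R) :
  compact [set: X] -> (forall a, continuous (d a)) -> (forall a, d a a = 0) ->
  0 < r -> exists s : seq X, forall x, exists2 a, a \in s & d a x < r.
Proof.
move=> cX cd dd r0.
apply: (@finite_subcover X X (fun a => d a @^-1` [set t | t < r])) => //.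
- by move=> a; apply: open_comp => [? _|]; [exact: cd|exact: open_lt].
- by move=> x; exists x; rewrite /= dd.
Qed.

(** The minimum of [v] on the compact set where [e <= u]. On [X * X] this plays the role of uniform
    continuity: it yields both [uniform_modulus] and [small_fibers_modulus]. *)
Lemma compact_pos_lower (R : realType) (Z : topologicalType) (u v : Z -> R) (e : R) :
  compact [set: Z] -> continuous u -> continuous v ->
  (forall z, e <= u z -> 0 < v z) ->
  exists2 r, 0 < r & forall z, e <= u z -> r <= v z.
Proof.
move=> cZ cu cv uv.
pose A := u @^-1` [set t | e <= t].
have cA : compact A.
  apply: (subclosed_compact _ cZ) => //.
  by apply: closed_comp => [? _|]; [exact: cu|exact: closed_ge].
have [A0|/set0P/negP/negPn/eqP A0] := pselect (A !=set0).
  have [c cA' hc] := compact_EVT_min A0 cA (continuous_subspaceT cv).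
  exists (v c); first by apply: uv; move: cA'; rewrite inE.
  by move=> z ez; apply: hc; rewrite inE.
exists 1 => // z ez.
by have : A z by []; rewrite A0.
Qed.

Lemma compact_setXT (X : topologicalType) :
  compact [set: X] -> compact [set: X * X].
Proof.
by move=> cX; rewrite -setXTT; apply: compact_setX.
Qed.

Lemma continuous_sumr (R : realType) (X : topologicalType) (I : Type) (r : seq I)
    (P : pred I) (F : I -> X -> R) :
  (forall i, P i -> continuous (F i)) ->
  continuous (fun x => \sum_(i <- r | P i) F i x).
Proof. by move=> cF; apply: continuous_big => //; exact: add_continuous. Qed.

Lemma continuous_prodr (R : realType) (X : topologicalType) (I : Type) (r : seq I)
    (P : pred I) (F : I -> X -> R) :
  (forall i, P i -> continuous (F i)) ->
  continuous (fun x => \prod_(i <- r | P i) F i x).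
Proof. by move=> cF; apply: continuous_big => //; exact: mul_continuous. Qed.

Lemma continuous_maxr (R : realType) (X : topologicalType) (f g : X -> R) :
  continuous f -> continuous g -> continuous (fun x => Num.max (f x) (g x)).
Proof. by move=> cf cg x; apply: continuous_max; [exact: cf|exact: cg]. Qed.

Lemma continuous_minr (R : realType) (X : topologicalType) (f g : X -> R) :
  continuous f -> continuous g -> continuous (fun x => Num.min (f x) (g x)).
Proof. by move=> cf cg x; apply: continuous_min; [exact: cf|exact: cg]. Qed.

Lemma continuous_subr (R : realType) (X : topologicalType) (V : normedModType R)
    (f g : X -> V) :
  continuous f -> continuous g -> continuous (fun x => f x - g x).
Proof. by move=> cf cg x; apply: cvgB; [exact: cf|exact: cg]. Qed.

Lemma continuous_row (R : realType) (X : topologicalType) (m : nat)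
    (f : 'I_m -> X -> R) :
  (forall i, continuous (f i)) -> continuous (fun x => \row_i f i x : 'rV[R]_m).
Proof.
move=> cf x A [P PA sPA].
have h i : \forall y \near x, P ord0 i (f i y).
  by apply: cf; have := PA ord0 i; rewrite mxE.
have {h} : \forall y \near x, forall i, P ord0 i (f i y) by apply: filter_forall.
apply: filterS => y hy; apply: sPA => i j.
by rewrite mxE ord1; exact: hy.
Qed.

(** * Products of simplicial complexes *)

Section product_complex.
Variable R : realType.

(** The endpoints of consecutive intervals of lengths [t ord0 j], which cut [0,1] when [t] is a
    point of a simplex. *)
Definition cumul m (t : 'rV[R]_m) (i : nat) : R := \sum_(j < m | (j < i)%N) t ord0 j.

(** The length of the intersection of interval [i] of [s] with interval [j] of [t]: a barycentric
    coordinate of (s,t) in the staircase triangulation of a product of simplices. The products s_i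
    t_j have the same marginals, but supports of size (d1+1)(d2+1), too large for dimensions to
    add. *)
Definition overlap m1 m2 (s : 'rV[R]_m1) (t : 'rV[R]_m2) (i j : nat) : R :=
  Num.max 0 (Num.min (cumul s i.+1) (cumul t j.+1) - Num.max (cumul s i) (cumul t j)).

Lemma overlapC m1 m2 (s : 'rV[R]_m1) (t : 'rV[R]_m2) i j :
  overlap s t i j = overlap t s j i.
Proof. by rewrite /overlap minC [Num.max (cumul s i) _]maxC. Qed.

Lemma cumul0 m (t : 'rV[R]_m) : cumul t 0 = 0.
Proof. by rewrite /cumul big_pred0. Qed.

Lemma cumul_full m (t : 'rV[R]_m) : cumul t m = \sum_(j < m) t ord0 j.
Proof. by apply: eq_bigl => j; rewrite ltn_ord. Qed.

Lemma cumulS m (t : 'rV[R]_m) (i : 'I_m) : cumul t i.+1 = t ord0 i + cumul t i.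
Proof.
rewrite /cumul (bigD1 i) //=; congr (_ + _); apply: eq_bigl => j.
by rewrite ltnS andbC ltn_neqAle.
Qed.

Lemma cumul_le m (t : 'rV[R]_m) i j :
  (forall i, 0 <= t ord0 i) -> (i <= j)%N -> cumul t i <= cumul t j.
Proof.
move=> t0 ij; rewrite /cumul [leRHS]big_mkcond [leLHS]big_mkcond /=.
apply: ler_sum => l _; case: ifP => [li|_]; last by case: ifP.
by rewrite (leq_trans li ij).
Qed.

Lemma overlap_sum m1 m2 (s : 'rV[R]_m1) (t : 'rV[R]_m2) (i : 'I_m1) :
  (forall i, 0 <= s ord0 i) -> \sum_i s ord0 i = 1 ->
  (forall i, 0 <= t ord0 i) -> \sum_i t ord0 i = 1 ->
  \sum_(j < m2) overlap s t i j = s ord0 i.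
Proof.
move=> s0 s1 t0 t1.
have a0 : 0 <= cumul s i by rewrite -(cumul0 s); exact: cumul_le.
have b1 : cumul s i.+1 <= 1 by rewrite -s1 -cumul_full; apply: cumul_le.
have ab := cumul_le s0 (leqnSn i).
have -> : s ord0 i = cumul s i.+1 - cumul s i by rewrite cumulS addrK.
set a := cumul s i in a0 ab *; set b := cumul s i.+1 in b1 ab *.
(* Clipping to [a,b]: each overlap is the increment of [c] along an interval of [t], so the sum
   telescopes. *)
pose c x := Num.max a (Num.min b x).
have -> : \sum_(j < m2) overlap s t i j = \sum_(j < m2) (c (cumul t j.+1) - c (cumul t j)).
  apply: eq_bigr => j _; rewrite /overlap -/a -/b /c.
  have := cumul_le t0 (leqnSn j).
  move: (cumul t j) (cumul t j.+1) => u v uv.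
  case: (leP b v) => h1; case: (leP b u) => h2; case: (leP a u) => h3;
  case: (leP a v) => h4; rewrite ?(max_r ab); case: leP => h5; lra.
rewrite -(big_mkord xpredT (fun j => c (cumul t j.+1) - c (cumul t j))).
rewrite (telescope_sumr (fun j => c (cumul t j))) // cumul_full t1 cumul0 /c.
rewrite (min_idPl b1) (max_r ab) (min_idPr (le_trans a0 ab)) (max_l a0) //.
Qed.

Lemma overlap_ge0 m1 m2 (s : 'rV[R]_m1) (t : 'rV[R]_m2) i j : 0 <= overlap s t i j.
Proof. by rewrite /overlap le_max lexx. Qed.

Lemma overlap_chain m1 m2 (s : 'rV[R]_m1) (t : 'rV[R]_m2) i j i' j' :
  (forall i, 0 <= s ord0 i) -> (forall i, 0 <= t ord0 i) ->
  overlap s t i j != 0 -> overlap s t i' j' != 0 -> (i < i')%N -> (j <= j')%N.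
Proof.
move=> s0 t0 h h' ii'; rewrite leqNgt; apply/negP => jj'.
have [A B] : cumul t j < cumul s i.+1 /\ cumul s i' < cumul t j'.+1.
  split; rewrite ltNge; apply/negP => le; [move/negP: h|move/negP: h'];
  apply; apply/eqP; rewrite /overlap; apply/max_idPl; rewrite subr_le0.
  - by rewrite ge_min le_max le orbT.
  - by rewrite ge_min !le_max le orbT.
have := cumul_le s0 ii'; have := cumul_le t0 jj'; lra.
Qed.

Lemma continuous_cumul (X : topologicalType) m (pi : X -> 'rV[R]_m) i :
  continuous pi -> continuous (fun x => cumul (pi x) i).
Proof.
move=> cpi; apply: continuous_sumr => j _ x.
apply: (@continuous_comp X 'rV[R]_m R pi (fun M => M ord0 j)); first exact: cpi.
exact: coord_continuous.
Qed.

Definition chain m1 m2 (s : {set 'I_m1 * 'I_m2}) :=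
  [forall p in s, forall q in s, (p.1 < q.1)%N ==> (p.2 <= q.2)%N].

(** Along a staircase the sum of the ranks of the two coordinates inside the projections takes
    distinct values, and it is at most the sum of the two cardinals minus 2. *)
Lemma chain_card m1 m2 (s : {set 'I_m1 * 'I_m2}) :
  chain s -> (0 < #|s|)%N ->
  (#|s| <= (#|[set p.1 | p in s]%SET|.-1 + #|[set p.2 | p in s]%SET|.-1).+1)%N.
Proof.
move=> /forall_inP cs s0.
set A := [set p.1 | p in s]%SET; set B := [set p.2 | p in s]%SET.
pose ra (i : 'I_m1) := #|[set a in A | (a < i)%N]%SET|.
pose rb (i : 'I_m2) := #|[set a in B | (a < i)%N]%SET|.
have sub1 i : i \in A -> (ra i <= #|A|.-1)%N.
  move=> iA; rewrite /ra (cardsD1 i A) iA add1n /=; apply: subset_leq_card.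
  apply/fintype.subsetP => a; rewrite !inE => /andP[-> ai].
  by rewrite andbT; apply: contraTneq ai => ->; rewrite ltnn.
have sub2 i : i \in B -> (rb i <= #|B|.-1)%N.
  move=> iA; rewrite /rb (cardsD1 i B) iA add1n /=; apply: subset_leq_card.
  apply/fintype.subsetP => a; rewrite !inE => /andP[-> ai].
  by rewrite andbT; apply: contraTneq ai => ->; rewrite ltnn.
have lt1 i (i' : 'I_m1) : i \in A -> (i < i')%N -> (ra i < ra i')%N.
  move=> iA ii'; apply: proper_card; apply/properP; split.
    by apply/fintype.subsetP => a; rewrite !inE => /andP[-> ai]; exact: ltn_trans ai ii'.
  by exists i; rewrite !inE ?iA ?ii' // ltnn andbF.
have lt2 i (i' : 'I_m2) : i \in B -> (i < i')%N -> (rb i < rb i')%N.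
  move=> iA ii'; apply: proper_card; apply/properP; split.
    by apply/fintype.subsetP => a; rewrite !inE => /andP[-> ai]; exact: ltn_trans ai ii'.
  by exists i; rewrite !inE ?iA ?ii' // ltnn andbF.
pose h (p : 'I_m1 * 'I_m2) := (ra p.1 + rb p.2)%N.
have memA p : p \in s -> p.1 \in A by move=> ps; apply/imsetP; exists p.
have memB p : p \in s -> p.2 \in B by move=> ps; apply/imsetP; exists p.
have mono p q : p \in s -> q \in s -> (p.1 < q.1)%N -> (h p < h q)%N.
  move=> ps qs pq; have := cs p ps => /forall_inP/(_ q qs)/implyP/(_ pq) le2.
  rewrite /h -addSn leq_add //; first exact: lt1 (memA _ ps) pq.
  move: le2; rewrite leq_eqVlt => /orP[/eqP/val_inj -> //|lt].
  by apply: ltnW; apply: lt2 => //; exact: memB.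
have hinj : {in s &, injective h}.
  move=> p q ps qs e.
  case: (ltngtP p.1 q.1) => [l|l|/val_inj e1].
  - by have := mono _ _ ps qs l; rewrite e ltnn.
  - by have := mono _ _ qs ps l; rewrite e ltnn.
  case: (ltngtP p.2 q.2) => [l|l|/val_inj e2].
  - by have := lt2 _ _ (memB _ ps) l; move: e; rewrite /h e1 => /addnI ->; rewrite ltnn.
  - by have := lt2 _ _ (memB _ qs) l; move: e; rewrite /h e1 => /addnI ->; rewrite ltnn.
  by case: p q e1 e2 {ps qs e} => [? ?] [? ?] /= -> ->.
pose D := (#|A|.-1 + #|B|.-1)%N.
have hD p : p \in s -> (h p <= D)%N.
  by move=> ps; rewrite leq_add ?sub1 ?sub2 ?memA ?memB.
have ci : {in s &, injective (fun p => inord (h p) : 'I_D.+1)}.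
  move=> p q ps qs /(congr1 val) /=; rewrite !inordK ?ltnS ?hD //; exact: hinj.
by rewrite -(card_in_imset ci) -[X in (_ <= X)%N](card_ord D.+1) max_card.
Qed.

Definition polymap (X : topologicalType) m (S : {set {set 'I_m}}) (pi : X -> 'rV[R]_m) :=
  [/\ is_simplicial_complex S, continuous pi & forall x, realization S (pi x)].

(** Simplices of the product are sets of vertex pairs that project to simplices and form a chain.
    The chain condition makes dimensions add, and the marginals of [overlap] recover both maps. This
    is the source of subadditivity of [widim]. *)
Lemma polymap_prod (X : topologicalType) m1 (S1 : {set {set 'I_m1}}) pi1
    m2 (S2 : {set {set 'I_m2}}) pi2 :
  @polymap X m1 S1 pi1 -> @polymap X m2 S2 pi2 ->
  exists m (S : {set {set 'I_m}}) pi, [/\ polymap S pi,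
    (complex_dim S <= complex_dim S1 + complex_dim S2)%N &
    forall x y : X, pi x = pi y -> pi1 x = pi1 y /\ pi2 x = pi2 y].
Proof.
move=> [[S1n S1h] c1 r1] [[S2n S2h] c2 r2].
pose P := ('I_m1 * 'I_m2)%type; pose m := #|{: P}|.
pose dec (e : 'I_m) : P := enum_val e.
pose cod (p : P) : 'I_m := enum_rank p.
have decK p : dec (cod p) = p by exact: enum_rankK.
have codK e : cod (dec e) = e by exact: enum_valK.
pose fs (s : {set 'I_m}) : {set P} := [set dec e | e in s]%SET.
pose f1 (s : {set 'I_m}) := [set p.1 | p in fs s]%SET.
pose f2 (s : {set 'I_m}) := [set p.2 | p in fs s]%SET.
pose S := [set s : {set 'I_m} |
  [&& (0 < #|s|)%N, f1 s \in S1, f2 s \in S2 & chain (fs s)]]%SET.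
pose pi x : 'rV[R]_m := \row_e overlap (pi1 x) (pi2 x) (dec e).1 (dec e).2.
have cfs s : #|fs s| = #|s| by rewrite card_imset //; exact: can_inj codK.
have posS x : [/\ forall i, 0 <= pi1 x ord0 i, \sum_i pi1 x ord0 i = 1,
    forall i, 0 <= pi2 x ord0 i & \sum_i pi2 x ord0 i = 1].
  by have [? [? _]] := r1 x; have [? [? _]] := r2 x; split.
have piE x i j : pi x ord0 (cod (i, j)) = overlap (pi1 x) (pi2 x) i j.
  by rewrite mxE decK.
have sum1 x (i : 'I_m1) : \sum_(j < m2) overlap (pi1 x) (pi2 x) i j = pi1 x ord0 i.
  by have [*] := posS x; apply: overlap_sum.
have sum2 x (j : 'I_m2) : \sum_(i < m1) overlap (pi1 x) (pi2 x) i j = pi2 x ord0 j.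
  have [*] := posS x; under eq_bigr do rewrite overlapC.
  by apply: overlap_sum.
exists m, S, pi; split; first split.
- split; first by move=> s; rewrite inE => /and4P[].
  move=> s t; rewrite !inE => /and4P[s0 sS1 sS2 sc] ts t0.
  have fts : fs t \subset fs s by apply: imsetS.
  rewrite t0 /=; apply/and3P; split.
  + apply: S1h sS1 _ _; first exact: imsetS.
    by rewrite card_gt0 imset_eq0 imset_eq0 -card_gt0.
  + apply: S2h sS2 _ _; first exact: imsetS.
    by rewrite card_gt0 imset_eq0 imset_eq0 -card_gt0.
  + apply/forall_inP => p pt; apply/forall_inP => q qt.
    move/forall_inP: sc => /(_ p (fintype.subsetP fts _ pt))/forall_inP.
    by apply; exact: (fintype.subsetP fts).
- apply: continuous_row => e; rewrite /overlap.
  apply: continuous_maxr; first by move=> x; exact: cvg_cst.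
  apply: continuous_subr.
    by apply: continuous_minr; exact: continuous_cumul.
  by apply: continuous_maxr; exact: continuous_cumul.
- move=> x; split; first by move=> e; rewrite mxE overlap_ge0.
  have [p1 q1 p2 q2] := posS x.
  have tot : \sum_(e < m) pi x ord0 e = 1.
    rewrite (reindex cod) /=; last by exists dec => ? _; rewrite ?codK ?decK.
    under eq_bigr do rewrite mxE decK.
    rewrite -(pair_bigA _ (fun (i : 'I_m1) (j : 'I_m2) => overlap (pi1 x) (pi2 x) i j)) /=.
    by under eq_bigr do rewrite sum1.
  split => //; set s := [set i | _]%SET.
  have e1 : f1 s = [set i | pi1 x ord0 i != 0]%SET.
    apply/setP => i; rewrite inE; apply/imsetP/idP.
      move=> [p /imsetP[e]]; rewrite inE mxE => h -> ->.
      rewrite -sum1; apply: contraNneq h => /eqP.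
      by rewrite psumr_eq0 => [/allP/(_ (dec e).2)|*]; rewrite ?mem_index_enum ?overlap_ge0 //; apply.
    move=> h; have : \sum_(j < m2) overlap (pi1 x) (pi2 x) i j != 0 by rewrite sum1.
    rewrite psumr_neq0 => [/hasP[j _ /= oj]|*]; last exact: overlap_ge0.
    exists (i, j) => //; apply/imsetP; exists (cod (i, j)); last by rewrite decK.
    by rewrite inE piE lt0r_neq0.
  have e2 : f2 s = [set i | pi2 x ord0 i != 0]%SET.
    apply/setP => i; rewrite inE; apply/imsetP/idP.
      move=> [p /imsetP[e]]; rewrite inE mxE => h -> ->.
      rewrite -sum2; apply: contraNneq h => /eqP.
      by rewrite psumr_eq0 => [/allP/(_ (dec e).1)|*]; rewrite ?mem_index_enum ?overlap_ge0 //; apply.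
    move=> h; have : \sum_(j < m1) overlap (pi1 x) (pi2 x) j i != 0 by rewrite sum2.
    rewrite psumr_neq0 => [/hasP[j _ /= oj]|*]; last exact: overlap_ge0.
    exists (j, i) => //; apply/imsetP; exists (cod (j, i)); last by rewrite decK.
    by rewrite inE piE lt0r_neq0.
  rewrite inE e1 e2; have [_ [_ ->]] := r1 x; have [_ [_ ->]] := r2 x.
  rewrite /=; apply/andP; split.
    rewrite card_gt0; apply/eqP => s0; move: tot; rewrite big1 => [/eqP|e _].
      by rewrite eq_sym oner_eq0.
    by apply/eqP; have := finset.in_set0 e; rewrite -s0 inE => /negbFE.
  apply/forall_inP => p /imsetP[e]; rewrite inE mxE => hp ->.
  apply/forall_inP => q /imsetP[e']; rewrite inE mxE => hq ->.
  by apply/implyP; apply: overlap_chain hp hq.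
- apply/bigmax_leqP => s; rewrite inE => /and4P[s0 sS1 sS2 sc].
  have := chain_card sc; rewrite cfs => /(_ s0) le.
  rewrite -ltnS (prednK s0); apply: (leq_trans le); rewrite ltnS leq_add //.
    by rewrite /complex_dim (bigD1 _ sS1) leq_maxl.
  by rewrite /complex_dim (bigD1 _ sS2) leq_maxl.
- move=> x y exy; have oxy i j : overlap (pi1 x) (pi2 x) (nat_of_ord i) (nat_of_ord j)
      = overlap (pi1 y) (pi2 y) (nat_of_ord (i : 'I_m1)) (nat_of_ord (j : 'I_m2)).
    by rewrite -!piE exy.
  split; apply/rowP => i.
    by rewrite -!sum1; apply: eq_bigr => j _; exact: oxy.
  by rewrite -!sum2; apply: eq_bigr => j _; exact: oxy.
Qed.

End product_complex.

(** * Boxes in Z^k and subadditivity *)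

Lemma norm_shift_ge0 (z c : int) : `|z| <= c -> 0 <= z + c.
Proof. lia. Qed.

Section boxes.
Variable k : nat.

Definition zpt N (j : {ffun 'I_k -> 'I_N}) : 'rV[int]_k := \row_i (j i : nat)%:Z.

Lemma zboxP N (n : 'rV[int]_k) : zbox k N n <-> exists j, n = @zpt N j.
Proof.
split=> [bn|[j ->] i]; last by rewrite mxE; split => //; have := ltn_ord (j i); lia.
have h i : (`|n ord0 i| < N)%N by have := bn i; lia.
exists [ffun i => Ordinal (h i)]; apply/rowP => i.
by rewrite mxE ffunE /=; have [b _] := bn i; rewrite gez0_abs.
Qed.

Lemma zbox_zpt N (j : {ffun 'I_k -> 'I_N}) : zbox k N (zpt j).
Proof. by apply/zboxP; exists j. Qed.

Lemma zpt_inj N : injective (@zpt N).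
Proof.
move=> j j' /rowP e; apply/ffunP => i; apply/val_inj.
by have := e i; rewrite !mxE; case.
Qed.

(** The centred cube of side 2b+1. The index bound is written [b + b.+1] so that [big_split_ord]
    separates negative coordinates from the others in [zweight_box]. *)
Definition cpt b (j : {ffun 'I_k -> 'I_(b + b.+1)}) : 'rV[int]_k :=
  zpt j - const_mx b%:Z.

Lemma cpt_inj b : injective (@cpt b).
Proof. by move=> j j' /addIr /zpt_inj. Qed.

Lemma cptP b (n : 'rV[int]_k) : (forall i, `|n ord0 i| <= b%:Z) -> exists j, n = @cpt b j.
Proof.
move=> hb.
have h i : (`|(n ord0 i + b%:Z)%R| < b + b.+1)%N by have := hb i; lia.
exists [ffun i => Ordinal (h i)]; apply/rowP => i; rewrite !mxE ffunE /=.
by rewrite gez0_abs ?addrK //; apply: norm_shift_ge0; exact: hb.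
Qed.

Lemma card_box N : #|{ffun 'I_k -> 'I_N}| = (N ^ k)%N.
Proof. by rewrite card_ffun !card_ord. Qed.

Lemma zbox_cover N J M (n : 'rV[int]_k) : (0 < N)%N -> (M <= J * N)%N ->
  zbox k M n -> exists (j : {ffun 'I_k -> 'I_J}) (n' : 'rV[int]_k),
    zbox k N n' /\ n = n' + zpt j *+ N.
Proof.
move=> N0 MJ /zboxP[f ->].
have h i : (f i %/ N < J)%N by rewrite ltn_divLR // (leq_trans _ MJ).
exists [ffun i => Ordinal (h i)], (\row_i (f i %% N)%N%:Z); split.
  by move=> i; rewrite mxE; have := ltn_pmod (f i) N0; lia.
apply/rowP => i; rewrite !mxE mulmxnE mxE ffunE /=.
by rewrite {1}(divn_eq (f i) N); lia.
Qed.

(** The window is finite, so the sum of the distances bounds the set and [sup] is a genuine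
    supremum; [0 <= c] serves the empty window, where [sup] is 0. *)
Lemma dyn_dist_leP (R : realType) (Y : Type) (T : 'rV[int]_k -> Y -> Y)
    (rho : Y -> Y -> R) N x y c :
  (forall x y, 0 <= rho x y) -> 0 <= c ->
  dyn_dist T rho (zbox k N) x y <= c <->
  forall n, zbox k N n -> rho (T n x) (T n y) <= c.
Proof.
move=> rho0 c0; rewrite /dyn_dist; set E := (X in sup X); split=> [h n bn|h].
  apply: le_trans h; apply: ub_le_sup; last by exists n.
  exists (\sum_(j : {ffun 'I_k -> 'I_N}) rho (T (zpt j) x) (T (zpt j) y)).
  move=> _ [_ /zboxP[j ->] <-]; rewrite (bigD1 j) //= lerDl.
  by apply: sumr_ge0.
have [E0|/set0P/negP/negPn/eqP ->] := pselect (E !=set0); last by rewrite sup0.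
by apply: ge_sup => // _ [n bn <-]; exact: h.
Qed.

End boxes.

(** A supremum below [e] amounts to a uniform bound below [e]. Asking for [0 <= c] is harmless and
    also fits an empty [A], whose diameter is -oo. *)
Lemma ediam_ltP (R : realType) (Y : Type) (rho : Y -> Y -> R) (A : set Y) e :
  0 < e -> (ediam rho A < e%:E)%E <->
  exists2 c, 0 <= c < e & forall x y, A x -> A y -> rho x y <= c.
Proof.
move=> e0; split=> [h|[c /andP[c0 ce] h]].
  have ub x y : A x -> A y -> ((rho x y)%:E <= ediam rho A)%E.
    by move=> Ax Ay; apply: ereal_sup_ubound; exists (x, y).
  move: h ub; case: (ediam rho A) => [r| |] // h ub; last first.
    by exists 0; [rewrite lexx|move=> x y Ax Ay; have := ub x y Ax Ay].
  exists (Num.max 0 r); first by rewrite le_max lexx /= gt_max e0 -lte_fin h.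
  by move=> x y Ax Ay; rewrite le_max; have := ub x y Ax Ay; rewrite lee_fin => ->; rewrite orbT.
apply: (@le_lt_trans _ _ c%:E); last by rewrite lte_fin.
by apply: ge_ereal_sup => _ [[x y] [/= Ax Ay] <-]; rewrite lee_fin h.
Qed.

Section growth.
Variable R : realType.

Lemma pow_ratio_le (k N : nat) (c : R) : 1 < c ->
  \forall M \near \oo, (((M + N) ^ k)%N)%:R <= c * ((M ^ k)%N)%:R.
Proof.
move=> c1.
have : \forall x \near (1:R), x ^+ k < c.
  have /cvgr_lt := @exprn_continuous R k 1.
  by rewrite /= expr1n => /(_ _ c1).
move=> /nbhs_ballP[d /= d0 hd].
near=> M.
have M0 : (0:R) < M%:R by rewrite ltr0n; near: M; exact: nbhs_infty_gt.
have hM : N%:R / d < (M%:R:R) by near: M; exact: nbhs_infty_gtr.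
rewrite -ler_pdivrMr; last by rewrite natrX exprn_gt0.
rewrite !natrX -expr_div_n; apply/ltW/hd; rewrite /ball /=.
rewrite natrD mulrDl divff ?gt_eqF // opprD addrA subrr sub0r normrN.
by rewrite ger0_norm ?divr_ge0 // ltr_pdivrMr // mulrC -ltr_pdivrMr.
Unshelve. all: by end_near. Qed.

(** The bound [B] comes from a single window size and is separate from [v N]: in [S_entropy_labels],
    [v] is the logarithm of a cover number and [B] that of a number of labels. *)
Lemma fekete_lt (k : nat) (v : nat -> R) (B : R) N c : 0 <= B -> (0 < N)%N ->
  (forall J M, (M <= J * N)%N -> v M <= ((J ^ k)%N)%:R * B) ->
  B / ((N ^ k)%N)%:R < c -> \forall M \near \oo, v M / ((M ^ k)%N)%:R < c.
Proof.
move=> B0 N0 vsub; set t := B / _ => tc.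
have Nk : (0:R) < ((N ^ k)%N)%:R by rewrite ltr0n expn_gt0 N0.
have t0 : 0 <= t by rewrite divr_ge0.
(* A factor above 1 with [c' * t < c], in a form that also makes sense for [t = 0]. *)
pose c' := 1 + (c - t) / (2 * (t + 1)).
have c'1 : 1 < c' by rewrite ltrDl divr_gt0; lra.
have c't : c' * t < c.
  rewrite /c' mulrDl mul1r -ltrBrDl.
  have -> : (c - t) / (2 * (t + 1)) * t = (c - t) * (t / (2 * (t + 1))) by ring.
  by rewrite gtr_pMr ?subr_gt0 // ltr_pdivrMr; lra.
have := pow_ratio_le k N c'1; apply: filter_app; near=> M => hM.
have M0 : (0 < M)%N by near: M; exact: nbhs_infty_gt.
have Mk : (0:R) < ((M ^ k)%N)%:R by rewrite ltr0n expn_gt0 M0.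
apply: le_lt_trans c't; rewrite ler_pdivrMr //.
have le1 : (M <= (M %/ N).+1 * N)%N by rewrite ltnW // ltn_ceil.
apply: (le_trans (vsub _ _ le1)).
have -> : c' * t * ((M ^ k)%N)%:R = c' * ((M ^ k)%N)%:R * t by ring.
apply: le_trans (ler_wpM2r t0 hM).
rewrite /t mulrA ler_pdivlMr // -mulrA [B * _]mulrC mulrA ler_wpM2r //.
rewrite -natrM ler_nat -expnMn; case: (k) => // k'; rewrite leq_exp2r //.
by rewrite mulSn addnC leq_add2r leq_trunc_div.
Unshelve. all: by end_near. Qed.

Lemma fekete_cvg (k : nat) (v : nat -> R) : (forall N, 0 <= v N) ->
  (forall N J M, (0 < N)%N -> (M <= J * N)%N -> v M <= ((J ^ k)%N)%:R * v N) ->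
  cvgn (fun M => v M / ((M ^ k)%N)%:R).
Proof.
move=> v0 vsub; set u := fun M => _; pose E := [set u N | N in [set N | (0 < N)%N]].
have lbE : has_lbound E by exists 0 => _ [N _ <-]; rewrite divr_ge0.
have E0 : E !=set0 by exists (u 1%N), 1%N.
apply/cvg_ex; exists (inf E); apply/cvgrPdist_lt => e e0.
have [_ [N /= N0 <-] hN] := inf_adherent e0 (conj E0 lbE).
have := fekete_lt (v0 N) N0 (fun J M => vsub N J M N0) hN.
apply: filter_app; near=> M => hM.
have M0 : (0 < M)%N by near: M; exact: nbhs_infty_gt.
have : inf E <= u M by apply: ge_inf => //; exists M.
rewrite -/(u M) in hM.
by rewrite ltr_norml => h; apply/andP; split; lra.
Unshelve. all: by end_near. Qed.

End growth.

(** * Mean dimension *)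

Section mean_dimension.
Variables (R : realType) (k : nat) (X : metricType R) (T : 'rV[int]_k -> X -> X).
Hypothesis cX : compact [set: X].
Hypothesis aT : is_Zk_action T.

(** The set [A] is arbitrary because maps for translated boxes are combined over the union of the
    translates before it is compared with a larger box. *)
Definition small_fibers (eps : R) m (pi : X -> 'rV[R]_m) (A : set 'rV[int]_k) :=
  forall p, exists2 c, 0 <= c < eps &
    forall x y, pi x = p -> pi y = p -> forall n, A n -> mdist (T n x) (T n y) <= c.

Definition epsmap (eps : R) (A : set 'rV[int]_k) (d : nat) :=
  exists m (S : {set {set 'I_m}}) (pi : X -> 'rV[R]_m),
    [/\ polymap S pi, small_fibers eps pi A & complex_dim S = d].

Lemma small_fibersS eps m (pi : X -> 'rV[R]_m) (A B : set 'rV[int]_k) :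
  B `<=` A -> small_fibers eps pi A -> small_fibers eps pi B.
Proof.
move=> BA h p; have [c c0 hc] := h p; exists c => // x y px py n /BA; exact: hc.
Qed.

Lemma widim_epsmap eps N : 0 < eps ->
  widim eps (dyn_dist T (@mdist R X) (zbox k N)) =
  inf [set (d%:R : R) | d in epsmap eps (zbox k N)].
Proof.
move=> e0; congr inf; apply/seteqP; split => [r [m [S [pi [h1 h2 h3 h4 ->]]]]|].
  exists (complex_dim S) => //; exists m, S, pi; split => // p.
  have /(ediam_ltP _ _ e0)[c c0 hc] := h4 p; exists c => // x y px py.
  by apply/dyn_dist_leP; [exact: mdist_ge0|case/andP: c0|exact: hc].
move=> _ [d [m [S [pi [[h1 h2 h3] h4 h5]]]] <-]; exists m, S, pi; split => //.
  move=> p; apply/(ediam_ltP _ _ e0); have [c c0 hc] := h4 p; exists c => // x y px py.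
  by apply/dyn_dist_leP; [exact: mdist_ge0|case/andP: c0|exact: hc].
by rewrite h5.
Qed.

(** The map [pi \o T j] has small fibers over the translate of [A] by [j]. The product of these maps
    over [js] serves the union, at the sum of the dimensions. *)
Lemma epsmap_translates eps m (S : {set {set 'I_m}}) (pi : X -> 'rV[R]_m) A
    (js : seq 'rV[int]_k) :
  0 < eps -> polymap S pi -> small_fibers eps pi A ->
  exists2 d, (d <= size js * complex_dim S)%N &
    epsmap eps [set n + j | n in A & j in [set` js]] d.
Proof.
move=> e0 pS sf; elim: js => [|j js [d dle [m' [S' [pi' [pS' sf' dS']]]]]].
  (* No translates: the constant map to a one-vertex complex, with an empty set of sites to
     control. *)
  exists 0%N => //; exists 1%N, [set [set: 'I_1]]%SET, (fun _ => const_mx 1); split.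
  - split; first split.
    + by move=> s; rewrite inE => /eqP ->; rewrite cardsT card_ord.
    + move=> s t; rewrite !inE => /eqP -> _; rewrite card_gt0 => /set0Pn[i it].
      by apply/eqP/setP => l; have -> : l = i; [rewrite [l]ord1 [i]ord1|rewrite it inE].
    + by move=> x; exact: cvg_cst.
    + move=> x; split; first by move=> i; rewrite mxE.
      rewrite big_ord1 mxE; split => //; rewrite inE; apply/eqP/setP => i.
      by rewrite !inE mxE oner_eq0.
  - by move=> p; exists 0; [rewrite lexx e0|move=> x y _ _ n [a Aa [b]]].
  - by rewrite /complex_dim big_set1 cardsT card_ord.
have [T0 [TD cT]] := aT.
have pSj : polymap S (pi \o T j).
  case: pS => h1 h2 h3; split => // [x|x]; last exact: h3.
  by apply: continuous_comp; [exact: cT|exact: h2].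
have [m2 [S2 [pi2 [pS2 d2 inj2]]]] := polymap_prod pSj pS'.
exists (complex_dim S2).
  by apply: (leq_trans d2); rewrite mulSn leq_add2l dS'.
exists m2, S2, pi2; split => // p.
have [[x0 px0]|none] := pselect (exists x, pi2 x = p); last first.
  by exists 0; [rewrite lexx e0|move=> x y px; case: none; exists x].
have [c1 /andP[c10 c1e] h1] := sf (pi (T j x0)).
have [c2 /andP[c20 c2e] h2] := sf' (pi' x0).
exists (Num.max c1 c2); first by rewrite le_max c10 gt_max c1e.
move=> x y px py _ [n An [l /= lj <-]].
have [ex1 ex2] : pi (T j x) = pi (T j x0) /\ pi' x = pi' x0 by apply: inj2; rewrite px px0.
have [ey1 ey2] : pi (T j y) = pi (T j x0) /\ pi' y = pi' x0 by apply: inj2; rewrite py px0.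
rewrite le_max; move: lj; rewrite inE => /orP[/eqP->|lj].
  by rewrite !TD h1.
by rewrite h2 ?orbT //; exists n => //; exists l.
Qed.

Lemma epsmap_sub eps N J M d : 0 < eps -> (0 < N)%N -> (M <= J * N)%N ->
  epsmap eps (zbox k N) d ->
  exists2 d', (d' <= J ^ k * d)%N & epsmap eps (zbox k M) d'.
Proof.
move=> e0 N0 MJ [m [S [pi [pS sf <-]]]].
have [d' dd' [m' [S' [pi' [pS' sf' e']]]]] := epsmap_translates
  [seq zpt j *+ N | j <- enum {ffun 'I_k -> 'I_J}] e0 pS sf.
exists d'; first by move: dd'; rewrite size_map -cardE card_box.
exists m', S', pi'; split => //; apply: small_fibersS sf' => n bn.
have [j [n' [bn' ->]]] := zbox_cover N0 MJ bn.
exists n' => //; exists (zpt j *+ N) => //=.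
by apply/mapP; exists j; rewrite ?mem_enum.
Qed.

(** This keeps the infimum in [widim] from running over an empty set. The map goes to the full
    simplex on a finite net, by a partition of unity subordinate to small balls: two points with the
    same image share a ball. *)
Lemma epsmap1 eps : 0 < eps -> exists d, epsmap eps (zbox k 1) d.
Proof.
move=> e0; pose r := eps / 4.
have r0 : 0 < r by rewrite divr_gt0.
have cd a : continuous (fun x : X => mdist a x).
  move=> x; apply: (@continuous_comp X (X * X)%type R (pair a) (fun z => mdist z.1 z.2)).
    by apply: cvg_pair; [exact: cvg_cst|exact: cvg_id].
  exact: continuous_mdist.
have [s hs] := finite_net cX cd (@mdistxx R X) r0.
pose m := size s; pose c (i : 'I_m) := tnth (in_tuple s) i.
pose w i x := Num.max 0 (r - mdist (c i) x).
have cw i : continuous (w i).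
  apply: continuous_maxr; first by move=> x; exact: cvg_cst.
  by apply: continuous_subr => [x|]; [exact: cvg_cst|exact: cd].
pose W x := \sum_i w i x.
have w0 i x : 0 <= w i x by rewrite le_max lexx.
have W0 x : 0 < W x.
  have [a /(nthP a)[i im <-] ar] := hs x.
  rewrite /W (bigD1 (Ordinal im)) //= ltr_wpDr //; first by apply: sumr_ge0.
  by rewrite lt_max subr_gt0 /c (tnth_nth a) ar orbT.
pose S := [set s : {set 'I_m} | (0 < #|s|)%N]%SET.
pose pi x : 'rV[R]_m := \row_i (w i x / W x).
have cpi : continuous pi.
  apply: continuous_row => i x; apply: cvgM; first exact: cw.
  apply: cvgV; first by rewrite gt_eqF.
  by apply: continuous_sumr => j _; exact: cw.
have pi1 x : \sum_i pi x ord0 i = 1.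
  have -> : \sum_i pi x ord0 i = \sum_i w i x / W x by apply: eq_bigr => i _; rewrite mxE.
  by rewrite -mulr_suml -/(W x) divff // gt_eqF // W0.
exists (complex_dim S), m, S, pi; split => //.
- split => //.
    by split=> [t|t u]; rewrite !inE.
  move=> x; split; first by move=> i; rewrite mxE divr_ge0 // ltW.
  split => //; rewrite inE card_gt0; apply/negP => /eqP e.
  have := pi1 x; rewrite big1 => [/eqP|i _]; first by rewrite eq_sym oner_eq0.
  by apply/eqP; have := finset.in_set0 i; rewrite -e inE => /negbFE.
- move=> p; exists (r + r); first by rewrite addr_ge0 ?ltW //= /r; lra.
  move=> x y px py n bn.
  have -> : n = 0.
    have /zboxP[j ->] := bn; apply/rowP => i; rewrite !mxE.
    by have := ltn_ord (j i); lia.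
  have [T0 _] := aT; rewrite !T0.
  have : \sum_i pi x ord0 i != 0 by rewrite pi1 oner_eq0.
  rewrite psumr_neq0 => [/hasP[i _ /= pi0]|i _]; last by rewrite mxE divr_ge0 // ltW.
  have near z : pi z = p -> mdist (c i) z <= r.
    move=> pz; rewrite -subr_ge0 leNgt; apply/negP => neg.
    move: pi0; rewrite px -pz mxE /w (max_idPl (ltW neg)) mul0r.
    by rewrite ltxx.
  apply: (le_trans (metric_triangle x (c i) y)).
  by rewrite lerD // ?near // metric_sym near.
Qed.

Lemma epsmap_ex eps N : 0 < eps -> exists d, epsmap eps (zbox k N) d.
Proof.
move=> e0; have [d hd] := epsmap1 e0.
have [||d' _ hd'] := @epsmap_sub eps 1 N N d e0 _ _ hd; rewrite ?muln1 //.
by exists d'.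
Qed.

Let v eps N := widim eps (dyn_dist T (@mdist R X) (zbox k N)).

Lemma widim_ge0 eps N : 0 < eps -> 0 <= v eps N.
Proof.
move=> e0; rewrite /v widim_epsmap //; apply: lb_le_inf.
  by have [d hd] := epsmap_ex N e0; exists d%:R, d.
by move=> _ [d _ <-].
Qed.

Lemma widim_le eps N d : 0 < eps -> epsmap eps (zbox k N) d -> v eps N <= d%:R.
Proof.
move=> e0 hd; rewrite /v widim_epsmap //; apply: ge_inf; last by exists d.
by exists 0 => _ [d' _ <-].
Qed.

Lemma widim_sub eps N J M : 0 < eps -> (0 < N)%N -> (M <= J * N)%N ->
  v eps M <= ((J ^ k)%N)%:R * v eps N.
Proof.
move=> e0 N0 MJ; have main d : epsmap eps (zbox k N) d -> v eps M <= ((J ^ k)%N)%:R * d%:R.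
  move=> hd; have [d' dd' hd'] := epsmap_sub e0 N0 MJ hd.
  by apply: (le_trans (widim_le e0 hd')); rewrite -natrM ler_nat.
have [d0 hd0] := epsmap_ex N e0.
have [J0|J0] := posnP (J ^ k)%N; first by have := main _ hd0; rewrite J0 !mul0r.
rewrite mulrC -ler_pdivrMr ?ltr0n // [v eps N]widim_epsmap //.
apply: lb_le_inf; first by exists d0%:R, d0.
by move=> _ [d hd <-]; rewrite ler_pdivrMr ?ltr0n // mulrC main.
Qed.

Lemma widim_antitone e1 e2 N : 0 < e1 -> e1 <= e2 -> v e2 N <= v e1 N.
Proof.
move=> e10 e12; have e20 := lt_le_trans e10 e12.
rewrite [v e1 N]widim_epsmap //; apply: lb_le_inf.
  by have [d hd] := epsmap_ex N e10; exists d%:R, d.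
move=> _ [d [m [S [pi [h1 h2 h3]]]] <-]; apply: widim_le => //.
exists m, S, pi; split => // p; have [c /andP[c0 c1] hc] := h2 p.
by exists c => //; rewrite c0 (lt_le_trans c1).
Qed.

Let widim_density eps : \bar R := limn (fun N => (v eps N / ((N ^ k)%N)%:R)%:E).

Lemma widim_density_cvg eps : 0 < eps -> cvgn (fun N => v eps N / ((N ^ k)%N)%:R).
Proof.
by move=> e0; apply: fekete_cvg => *; [exact: widim_ge0|exact: widim_sub].
Qed.

Lemma widim_densityE eps : 0 < eps -> widim_density eps = (limn (fun N => v eps N / ((N ^ k)%N)%:R))%:E.
Proof. by move=> e0; rewrite -EFin_lim //; exact: widim_density_cvg. Qed.

Lemma widim_density_antitone e1 e2 : 0 < e1 -> e1 <= e2 -> (widim_density e2 <= widim_density e1)%E.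
Proof.
move=> e10 e12; have e20 := lt_le_trans e10 e12.
rewrite !widim_densityE // lee_fin; apply: ler_lim; [exact: widim_density_cvg|exact: widim_density_cvg|].
by near=> N; rewrite ler_wpM2r ?invr_ge0 ?widim_antitone.
Unshelve. all: by end_near. Qed.

Lemma mean_dim_cvg : cvg (widim_density eps @[eps --> 0^'+]).
Proof.
apply: nonincreasing_at_right_is_cvge; near=> x => e1 e2.
by rewrite !in_itv /= => /andP[e10 _] /andP[e20 _] le; exact: widim_density_antitone.
Unshelve. all: by end_near. Qed.

Lemma mean_dim_ge0 : (0 <= mean_dim T)%E.
Proof.
apply: lime_ge; first exact: mean_dim_cvg.
near=> eps; have e0 : 0 < eps by near: eps; exact: nbhs_right_gt.
rewrite -/(widim_density eps) widim_densityE // lee_fin; apply: limr_ge; first exact: widim_density_cvg.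
by near=> N; rewrite divr_ge0 ?widim_ge0.
Unshelve. all: by end_near. Qed.

(** Unfolds the iterated limit into one scale below [eps], one window and one nearly optimal map;
    fibers small at the lower scale are small at scale [eps]. *)
Lemma mean_dim_lt (a eps : R) : (mean_dim T < a%:E)%E -> 0 < eps ->
  exists L d, [/\ (0 < L)%N, epsmap eps (zbox k L) d & d%:R < a * ((L ^ k)%N)%:R].
Proof.
move=> ma e0.
have near_lt : \forall x \near 0^'+, (widim_density x < a%:E)%E.
  have /(_ [set u | (u < a%:E)%E]) := mean_dim_cvg; apply; exact: (open_ereal_lt' ma).
have [e1 [e10 e1e he1]] : exists e1, [/\ 0 < e1, e1 < eps & (widim_density e1 < a%:E)%E].
  near (0:R)^'+ => e1; exists e1; split.
  - near: e1; exact: nbhs_right_gt.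
  - near: e1; exact: nbhs_right_lt.
  - by near: e1; exact: near_lt.
rewrite widim_densityE // lte_fin in he1.
have nearN := cvgr_lt _ (widim_density_cvg e10) _ he1.
near \oo => L.
have L0 : (0 < L)%N by near: L; exact: nbhs_infty_gt.
have Lk : (0:R) < ((L ^ k)%N)%:R by rewrite ltr0n expn_gt0 L0.
have hL : v e1 L / ((L ^ k)%N)%:R < a by near: L; exact: nearN.
rewrite ltr_pdivrMr // in hL.
have /inf_adherent : (0 : R) < a * ((L ^ k)%N)%:R - v e1 L by rewrite subr_gt0.
move=> /(_ [set (d%:R : R) | d in epsmap e1 (zbox k L)])[|_ [d hd <-]].
  split; last by exists 0 => _ [d' _ <-].
  by have [d hd] := epsmap_ex L e10; exists d%:R, d.
rewrite -widim_epsmap // -/(v e1 L) addrC subrK => dl.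
exists L, d; split => //.
have [m [S [pi [h1 h2 h3]]]] := hd; exists m, S, pi; split => // p.
have [c /andP[c0 c1] hc] := h2 p.
by exists c => //; rewrite c0 (lt_trans c1).
Unshelve. all: by end_near. Qed.

End mean_dimension.

(** * Power diagrams in Z^k *)

Section near_best.
Variables (R : realType) (k : nat).

Definition sqnorm (n : 'rV[int]_k) : int := \sum_i n ord0 i ^+ 2.

Variables (C : set 'rV[int]_k) (tau : 'rV[int]_k -> R).

(** The score of [n] seen from [m] is the power distance |m-n|^2 + tau n. The slack 1 is the width
    at which the continuous weights [wt] of [soft_tower] vanish. *)
Definition near_best (m n : 'rV[int]_k) := C n /\ forall n', C n' ->
  (sqnorm (m - n))%:~R + tau n < (sqnorm (m - n'))%:~R + tau n' + 1.

Definition touches (E : nat) (a n : 'rV[int]_k) := exists2 m : 'rV[int]_k,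
  (forall i, `|a ord0 i - m ord0 i| <= E%:Z) & near_best m n.

Variables (q E : nat) (r : int).
Hypothesis q2 : (1 < q)%N.
(** A bound for the coordinates of (q-1)(a-m)+v when |a-m| is at most [E] and 0 <= v < q-1; these
    are the perturbations that the separation [r] of the centres has to absorb. *)
Let w := ((q.-1) * E.+1)%N%:Z.
Hypothesis r_w : 2 * w <= r.
Hypothesis r_large : q%:Z + k%:Z * w ^+ 2 <= r * (r - 2 * w).
Hypothesis C_sep : forall n n', C n -> C n' -> n != n' ->
  exists i, r <= `|n ord0 i - n' ord0 i|.

(* Differences of scores are affine, so contracting by the factor (q-1)/q towards the
   centre n, where n beats every other centre by the squared distance, turns near
   optimality of n into optimality with room for a perturbation; everything is scaled
   by q to remain in the lattice. *)
Lemma contracted_best a n n' (v : 'rV[int]_k) :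
  touches E a n -> C n' -> n' != n ->
  (forall i, 0 <= v ord0 i < (q.-1)%:Z) ->
  (sqnorm (a *+ q.-1 + n + v - n *+ q))%:~R + (q * q.-1)%N%:R * tau n <
  (sqnorm (a *+ q.-1 + n + v - n' *+ q))%:~R + (q * q.-1)%N%:R * tau n'.
Proof.
move=> [m am [Cn nb]] Cn' nn' hv; have {nb} := nb n' Cn'.
pose p := (q.-1)%:Z; pose d i := n ord0 i - n' ord0 i.
pose z i := (q.-1)%:Z * (a ord0 i - m ord0 i) + v ord0 i.
have p0 : 0 < p by rewrite /p; lia.
have w0 : 0 <= w by [].
have wE : w = p * E%:Z + p by rewrite /w /p; nia.
have zw i : `|z i| <= w.
  have /andP[v0 v1] := hv i; have h := am i; rewrite /z -/p.
  apply: (le_trans (ler_normD _ _)); rewrite normrM (ger0_norm v0) gtr0_norm //.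
  by rewrite wE lerD ?(ltW v1) // ler_pM2l.
have lowi i : - w ^+ 2 <= d i ^+ 2 + 2 * z i * d i.
  have : z i ^+ 2 <= w ^+ 2 by rewrite -[z i ^+ 2]real_normK ?num_real // ler_sqr ?nnegrE.
  have : 0 <= (d i + z i) ^+ 2 by rewrite sqr_ge0.
  have -> : (d i + z i) ^+ 2 = d i ^+ 2 + 2 * z i * d i + z i ^+ 2 by ring.
  move=> *; lia.
(* Some coordinate carries the separation and contributes at least [r * (r - 2 * w)]; by completing
   the square, the others lose at most [k * w ^ 2] together. *)
have low : q%:Z <= \sum_i (d i ^+ 2 + 2 * z i * d i).
  have [i0 hi0] := C_sep Cn Cn' (contra_neq (fun e => esym e) nn').
  rewrite (bigD1 i0) //=.
  have : \sum_(i < k | i != i0) (- w ^+ 2) <= \sum_(i < k | i != i0) (d i ^+ 2 + 2 * z i * d i).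
    by apply: ler_sum => i _; exact: lowi.
  have : - (k%:Z * w ^+ 2) <= \sum_(i < k | i != i0) (- w ^+ 2).
    have : \sum_(i < k) (- w ^+ 2) = - (k%:Z * w ^+ 2).
      by rewrite sumr_const card_ord -mulr_natl natz mulrN.
    have := sqr_ge0 w.
    by rewrite (bigD1 i0) //=; move=> h <-; rewrite gerDr; lia.
  have : r * (r - 2 * w) <= d i0 ^+ 2 + 2 * z i0 * d i0.
    have h1 : r * (r - 2 * w) <= `|d i0| * (`|d i0| - 2 * w).
      apply: ler_pM => //; rewrite ?subr_ge0 ?lerD2r //.
      by apply: le_trans r_w; rewrite mulr_ge0.
    apply: (le_trans h1); rewrite mulrBr -expr2 real_normK ?num_real // lerD2l.
    have : `|2 * z i0 * d i0| <= `|d i0| * (2 * w).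
      rewrite !normrM [`|2|]ger0_norm // [leRHS]mulrC ler_wpM2r // ler_pM2l //.
    by rewrite ler_norml => /andP[].
  move: r_large => h0 h1 h2 h3.
  have h4 := lerD h1 (le_trans h2 h3); apply: le_trans h4.
  by rewrite lerBrDr.
move=> hs.
(* The score difference at the contracted point is q(q-1) times that at [m], plus [q] times the sum
   just bounded. Near optimality costs at most q(q-1), and the sum returns at least q*q. *)
have id : sqnorm (a *+ q.-1 + n + v - n' *+ q) - sqnorm (a *+ q.-1 + n + v - n *+ q) =
   (q * q.-1)%N%:Z * (sqnorm (m - n') - sqnorm (m - n)) +
   q%:Z * \sum_i (d i ^+ 2 + 2 * z i * d i).
  rewrite /sqnorm -!sumrB !mulr_sumr -big_split /=; apply: eq_bigr => i _.
  rewrite !mxE !mulmxnE /d /z PoszM.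
  have natE (x : int) j : x *+ j = j%:Z * x by rewrite -mulr_natl natz.
  rewrite !natE -/p; have -> : q%:Z = p + 1 by rewrite /p; lia.
  ring.
have {}low : (q * q)%N%:Z <= q%:Z * \sum_i (d i ^+ 2 + 2 * z i * d i).
  by rewrite PoszM ler_pM2l //; lia.
have Q0 : 0 < (q * q.-1)%N%:R :> R by rewrite ltr0n muln_gt0; lia.
have Qq : (q * q.-1)%N%:R <= (q * q)%N%:R :> R by rewrite ler_nat leq_mul2l; lia.
set S := \sum_i _ in id low.
have id' : (sqnorm (a *+ q.-1 + n + v - n' *+ q))%:~R =
    (sqnorm (a *+ q.-1 + n + v - n *+ q))%:~R + (q * q.-1)%N%:R *
    ((sqnorm (m - n'))%:~R - (sqnorm (m - n))%:~R) + (q%:Z * S)%:~R :> R.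
  have -> : sqnorm (a *+ q.-1 + n + v - n' *+ q) = sqnorm (a *+ q.-1 + n + v - n *+ q) +
     ((q * q.-1)%N%:Z * (sqnorm (m - n') - sqnorm (m - n)) + q%:Z * S).
    by rewrite -id [RHS]addrC subrK.
  by rewrite !intrD intrM intrB addrA.
have lowR : (q * q)%N%:R <= (q%:Z * S)%:~R :> R by rewrite -(ler_int R) in low.
move: hs; rewrite -(ltr_pM2l Q0) id' !mulrDr mulr1 mulrN.
lra.
Qed.

Definition ambiguous M : {set {ffun 'I_k -> 'I_M}} :=
  [set a | `[< exists n n', [/\ n != n', touches E (zpt a) n & touches E (zpt a) n'] >]]%SET.

Lemma ambiguous_card M b :
  (forall a : {ffun 'I_k -> 'I_M}, exists n, touches E (zpt a) n) ->
  (forall (a : {ffun 'I_k -> 'I_M}) n, touches E (zpt a) n ->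
     forall i, `|(zpt a) ord0 i - n ord0 i| <= b%:Z) ->
  ((q.-1) ^ k * (M ^ k + #|ambiguous M|) <= (q * M + 2 * b + q) ^ k)%N.
Proof.
move=> /choice[c0 c0P] hb.
have : forall a : {ffun 'I_k -> 'I_M}, exists n, a \in ambiguous M ->
    touches E (zpt a) n /\ n != c0 a.
  move=> a; have [am|nam] := boolP (a \in ambiguous M); last by exists 0.
  move: am; rewrite inE => /asboolP[n [n' [nn' tn tn']]].
  have [e|ne] := eqVneq n (c0 a); last by exists n.
  by exists n' => _; split => //; rewrite -e eq_sym.
move=> /choice[c1 c1P].
pose Site := ({ffun 'I_k -> 'I_M} + {a : {ffun 'I_k -> 'I_M} | a \in ambiguous M})%type.
pose site (s : Site) := match s with inl a => a | inr a => val a end.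
pose ctr (s : Site) := match s with inl a => c0 a | inr a => c1 (val a) end.
have ctrP s : touches E (zpt (site s)) (ctr s).
  by case: s => [a|[a am]] /=; [exact: c0P|have [] := c1P a am].
pose y (d : Site * {ffun 'I_k -> 'I_q.-1}) : 'rV[int]_k :=
  zpt (site d.1) *+ q.-1 + ctr d.1 + zpt d.2.
have natE (x : int) j : x *+ j = j%:Z * x by rewrite -mulr_natl natz.
have yb d i : 0 <= y d ord0 i + b%:Z < (q * M + 2 * b + q)%N%:Z.
  have := hb _ _ (ctrP d.1) i; rewrite /y !mxE mulmxnE !mxE natE.
  have := ltn_ord (site d.1 i); have := ltn_ord (d.2 i).
  move: (site d.1 i : nat) (d.2 i : nat) (ctr d.1 ord0 i) => a v c vq aM.
  rewrite ler_norml => /andP[h1 h2].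
  have : ((q.-1) * a + a <= (q.-1) * M + M)%N by rewrite -!mulSnr leq_mul2l ltnW ?orbT.
  have -> : (q * M = (q.-1) * M + M)%N by rewrite -mulSnr prednK // ltnW.
  have : 0 <= (q.-1)%:Z * a%:Z by [].
  rewrite -PoszM; move: (q.-1 * a)%N (q.-1 * M)%N => u1 u2 *; lia.
have yb' d i : (`|(y d ord0 i + b%:Z)%R| < q * M + 2 * b + q)%N.
  by have := yb d i; lia.
pose g d : {ffun 'I_k -> 'I_(q * M + 2 * b + q)} := [ffun i => Ordinal (yb' d i)].
have gy d d' : g d = g d' -> y d = y d'.
  move=> /ffunP e; apply/rowP => i; have := congr1 val (e i); rewrite !ffunE /=.
  by have := yb d i; have := yb d' i; change (y d 0 i) with (y d ord0 i);
     change (y d' 0 i) with (y d' ord0 i); lia.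
have vb (v : {ffun 'I_k -> 'I_q.-1}) i : 0 <= zpt v ord0 i < (q.-1)%:Z.
  by rewrite mxE; have := ltn_ord (v i); lia.
(* A point strictly prefers the centre it was contracted to, so it cannot come from two centres. *)
have ctr_eq d d' : y d = y d' -> ctr d.1 = ctr d'.1.
  move=> e; apply/eqP; apply/negPn/negP => ne.
  have [_ _ [Cn _]] := ctrP d.1; have [_ _ [Cn' _]] := ctrP d'.1.
  have h1 := contracted_best (ctrP d.1) Cn' (contra_neq (fun e => esym e) ne) (vb d.2).
  have h2 := contracted_best (ctrP d'.1) Cn ne (vb d'.2).
  move: h1 h2; rewrite -/(y d) -/(y d') e => h1 h2.
  by have := lt_trans h1 h2; rewrite ltxx.
(* With the centre cancelled, what remains is (q-1)a+v with v < q-1, and Euclidean division recovers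
   both. *)
have site_eq d d' : y d = y d' -> site d.1 = site d'.1 /\ d.2 = d'.2.
  move=> e; have ec := ctr_eq _ _ e.
  have h i : ((q.-1) * site d.1 i + d.2 i = (q.-1) * site d'.1 i + d'.2 i)%N.
    have /rowP/(_ i) := e; rewrite /y ec !mxE !mulmxnE !mxE !natE.
    rewrite -!PoszM; move: (ctr d'.1 _ _) => c.
    move: (q.-1 * _)%N (q.-1 * _)%N => u1 u2; lia.
  have hd i : (site d.1 i = site d'.1 i :> nat) /\ (d.2 i = d'.2 i :> nat).
    have q1 : (0 < q.-1)%N by lia.
    have := h i; move=> hi; split.
      by have := congr1 (fun z => z %/ q.-1)%N hi; rewrite !(mulnC q.-1) !divnMDl // !divn_small // !addn0.
    by have := congr1 (fun z => z %% q.-1)%N hi; rewrite !(mulnC q.-1) !modnMDl !modn_small.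
  by split; apply/ffunP => i; apply/val_inj; have [] := hd i.
have ginj : injective g.
  move=> [s v] [s' v'] /gy e; have [/= es ->] := site_eq _ _ e; congr (_, _).
  have /= := ctr_eq _ _ e; move: es; case: s e => [a|[a am]] e; case: s' e => [a'|[a' am']] _ /=.
  - by move=> ->.
  - by move=> ->; have [_ /eqP ne] := c1P a' am' => eq; case: ne; rewrite eq.
  - by move=> <-; have [_ /eqP ne] := c1P a am => eq; case: ne.
  - by move=> aa' _; congr inr; apply/val_inj.
have := leq_card g ginj.
by rewrite card_prod card_sum card_sig !card_box mulnC.
Qed.

End near_best.

(** * Soft towers from markers *)

Lemma open_positivity_set (R : realType) (X : metricType R) (U : set X) : open U ->
  exists rho : X -> R, [/\ continuous rho, forall x, 0 <= rho x & forall x, 0 < rho x <-> U x].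
Proof.
(* The distance to the complement truncated at 1; the extra element keeps the set nonempty when [U]
   is all of [X]. *)
move=> oU; pose D x : set R := [set t | t = 1 \/ exists2 y, ~ U y & t = mdist x y].
have D0 x : D x !=set0 by exists 1; left.
have lb x : lbound (D x) 0 by move=> _ [->|[y _ ->]] //; exact: mdist_ge0.
have hlb x : has_lbound (D x) by exists 0; exact: lb.
have lip x y : inf (D x) <= inf (D y) + mdist x y.
  rewrite -lerBlDr; apply: lb_le_inf => // _ [->|[z Uz ->]].
    rewrite lerBlDr; apply: (@le_trans _ _ 1); last by rewrite lerDl mdist_ge0.
    by apply: ge_inf => //; left.
  rewrite lerBlDr addrC; apply: le_trans (metric_triangle x y z).
  by apply: ge_inf => //; right; exists z.
exists (fun x => inf (D x)); split.
- move=> x; apply/cvgrPdist_le => e e0.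
  apply/nbhs_ballP; exists e => //= y; rewrite ballEmdist /= => xy.
  have := lip x y; have := lip y x; rewrite (metric_sym y x) => h1 h2.
  by rewrite ler_norml; apply/andP; split; lra.
- by move=> x; apply: lb_le_inf.
- move=> x; split=> [h|Ux].
    apply: contrapT => nU; have : inf (D x) <= mdist x x by apply: ge_inf => //; right; exists x.
    by rewrite mdistxx leNgt h.
  have /nbhs_ballP[e /= e0 he] : nbhs x U by apply: open_nbhs_nbhs; split.
  apply: (@lt_le_trans _ _ (Num.min 1 e)); first by rewrite lt_min ltr01.
  apply: lb_le_inf => // _ [->|[y Uy ->]]; first by rewrite ge_min lexx.
  rewrite ge_min; apply/orP; right; rewrite leNgt; apply/negP => xy; apply: Uy; apply: he.
  by rewrite ballEmdist.
Qed.

Lemma sqnorm_coord k (n : 'rV[int]_k) i : `|n ord0 i| <= sqnorm n.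
Proof.
rewrite /sqnorm (bigD1 i) //=; apply: (@le_trans _ _ (n ord0 i ^+ 2)).
  by rewrite -[n ord0 i ^+ 2]real_normK ?num_real //; move: `|n ord0 i| (normr_ge0 (n ord0 i)) => z z0; nia.
by rewrite lerDl sumr_ge0 // => j _; rewrite sqr_ge0.
Qed.

Lemma sqnorm_ge0 k (n : 'rV[int]_k) : 0 <= sqnorm n.
Proof. by apply: sumr_ge0 => i _; rewrite sqr_ge0. Qed.

Lemma sqnormN k (n : 'rV[int]_k) : sqnorm (- n) = sqnorm n.
Proof. by apply: eq_bigr => i _; rewrite mxE sqrrN. Qed.

Section tower.
Variables (R : realType) (k : nat) (X : metricType R) (T : 'rV[int]_k -> X -> X).
Hypothesis cX : compact [set: X].
Hypothesis aT : is_Zk_action T.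
Hypothesis mT : marker_property T.

(** Off [U] the penalty is [b + 1], while every point has a visit of score at most [b] among the
    shifts of squared length at most [b]. Hence only visits can win, and since [tau] is continuous,
    a centre loses its influence before its orbit point leaves [U]. *)
Lemma marker_function (r : nat) :
  exists (b : nat) (tau : X -> R) (U : set X),
  [/\ continuous tau, forall x, 0 <= tau x, forall x, ~ U x -> tau x = b%:R + 1,
      forall x, exists2 n, sqnorm n <= b%:Z & tau (T n x) = 0 &
      forall x n n', U (T n x) -> U (T n' x) -> n != n' ->
        exists i, r%:Z <= `|n ord0 i - n' ord0 i|].
Proof.
have [T0 [TD cT]] := aT.
pose F : set 'rV[int]_k := [set n | forall i, `|n ord0 i| < r%:Z].
have finF : finite_set F.
  apply: (@sub_finite_set _ _ [set cpt j | j in [set: {ffun 'I_k -> 'I_(r + r.+1)}]]).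
    by move=> n hn; have [i|j ->] := @cptP k r n; [exact/ltW/hn|exists j].
  by apply: finite_image; exact: finite_finset.
have [U [oU [cover disj]]] := mT finF.
have [rho [crho rho0 rhoU]] := open_positivity_set oU.
have [s hs] : exists s : seq ('rV[int]_k * nat), forall x,
    exists2 nj, nj \in s & nj.2.+1%:R^-1 < rho (T nj.1 x).
  apply: (@finite_subcover _ _ (fun nj : 'rV[int]_k * nat => [set x | nj.2.+1%:R^-1 < rho (T nj.1 x)])) => //.
    move=> [n j]; apply: (@open_comp _ _ (rho \o T n) [set t | j.+1%:R^-1 < t]).
      by move=> x _; apply: continuous_comp; [exact: cT|exact: crho].
    exact: open_gt.
  move=> x; have : [set: X] x by [].
  rewrite -cover => -[n _ [u Uu ux]].
  have pu : 0 < rho u by apply/rhoU.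
  have : u = T (- n) x by rewrite -ux -TD addNr T0.
  near \oo => j => eu; exists (- n, j); rewrite /= -eu.
  rewrite invf_plt ?posrE ?ltr0n //.
  by apply: (@lt_trans _ _ j%:R); [near: j; exact: nbhs_infty_gtr|rewrite ltr_nat].
(* Sums over the subcover serve as common upper bounds: [J.+1 * rho >= 1] at the point supplied by
   the subcover, so [tau] vanishes there. *)
pose b := (\sum_(nj <- s) `|sqnorm nj.1|)%N; pose J := (\sum_(nj <- s) nj.2)%N.
pose tau x := (b%:R + 1) * Num.max 0 (1 - J.+1%:R * rho x) : R.
have b1 : 0 < b%:R + 1 :> R by rewrite ltr_wpDl.
exists b, tau, U; split.
- have cm : continuous (fun x => Num.max 0 (1 - J.+1%:R * rho x)).
    apply: continuous_maxr; first by move=> y; exact: cvg_cst.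
    apply: continuous_subr => y; first exact: cvg_cst.
    by apply: cvgM; [exact: cvg_cst|exact: crho].
  by move=> x; apply: cvgM; [exact: cvg_cst|exact: cm].
- by move=> x; rewrite mulr_ge0 ?(ltW b1) // le_max lexx.
- move=> x nUx; have -> : tau x = (b%:R + 1) * 1; last by rewrite mulr1.
  have r0 : rho x = 0.
    by apply/eqP; rewrite eq_le rho0 andbT leNgt; apply/negP => /rhoU.
  by rewrite /tau r0 mulr0 subr0 (max_idPr _).
- move=> x; have [[n j] /= njs lt] := hs x; exists n.
    rewrite /b (big_rem _ njs) /= PoszD; have := sqnorm_ge0 n.
    by move: (sqnorm n) (\sum_(_ <- _) _)%N => u v; lia.
  rewrite /tau (max_idPl _) ?mulr0 // subr_le0.
  have jJ : (j <= J)%N by rewrite /J (big_rem _ njs) /= leq_addr.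
  apply: (@le_trans _ _ (j.+1%:R * rho (T n x))); last by rewrite ler_wpM2r ?ler_nat.
  by rewrite mulrC -ler_pdivrMr ?ltr0n // mul1r ltW.
- move=> x n n' Un Un' nn'; apply: contrapT => /forallNP h.
  have Fn : F (n - n').
    by move=> i; rewrite !mxE ltNge; apply/negP; exact: h.
  have := disj _ Fn; rewrite subr_eq0 nn' => /(_ isT)/seteqP[/(_ (T n x)) + _]; apply.
  by split => //; exists (T n' x) => //; rewrite -TD subrK.
Unshelve. all: by end_near. Qed.

Section lam.
Variables (L : nat) (lam : {ffun 'I_k -> 'I_L} -> X -> R).

Definition clean_starts M x : {set {ffun 'I_k -> 'I_M}} :=
  [set j : {ffun 'I_k -> 'I_M} | `[< (forall i, (j i + L <= M)%N) /\
     forall p, lam p (T (zpt j + zpt p) x) = 1 >]]%SET.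

Definition clean_sites M x : {set {ffun 'I_k -> 'I_M}} :=
  [set a : {ffun 'I_k -> 'I_M} | [exists j in clean_starts M x, exists p : {ffun 'I_k -> 'I_L},
     zpt a == zpt j + zpt p]]%SET.

End lam.

(** Each cell is tiled by boxes of side [L] anchored at its centre, and [lam p x] is the share of
    the near-best centres for which the site of [x] has position [p] in its box. Where only one
    centre is near, whole boxes have all shares equal to 1. *)
Lemma soft_tower (L : nat) (theta : R) : (0 < L)%N -> 0 < theta ->
  exists lam : {ffun 'I_k -> 'I_L} -> X -> R,
  [/\ forall p, continuous (lam p), forall p x, 0 <= lam p x,
      forall x, \sum_p lam p x = 1 &
      \forall M \near \oo, forall x,
        #|~: clean_sites lam M x|%:R <= theta * ((M ^ k)%N)%:R].
Proof.
move=> L0 th0; have [T0 [TD cT]] := aT.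
(* Half of [theta] pays for the ambiguous sites, the other half for the margin of the window. *)
pose c : R := 1 + theta / 2; have c1 : 1 < c by rewrite ltrDl divr_gt0.
(* [ambiguous_card] compares (q-1)^k copies per site with a cube of side at most (q+1)M, so this
   ratio must be close to 1. *)
have [q q2 hq] : exists2 q, (1 < q)%N &
    ((q.+1 ^ k)%N)%:R <= c * (((q.-1) ^ k)%N)%:R.
  have [N0 _ hN] := pow_ratio_le k 2 c1; exists N0.+2 => //=.
  by have := hN N0.+1 (leqnSn _); rewrite addn2.
(* The separation is chosen so that [r - 2 * w] equals [q + k * w ^ 2] exactly. *)
pose w := (q.-1 * L.+1)%N; pose r := (2 * w + q + k * w ^ 2)%N.
have r_w : 2 * w%:Z <= r%:Z by rewrite /r; lia.
have r_large : q%:Z + k%:Z * w%:Z ^+ 2 <= r%:Z * (r%:Z - 2 * w%:Z).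
  have -> : r%:Z - 2 * w%:Z = q%:Z + k%:Z * w%:Z ^+ 2 by rewrite /r !PoszD !PoszM; lia.
  have : 0 <= k%:Z * w%:Z ^+ 2 by rewrite mulr_ge0 ?sqr_ge0.
  have : 1 <= r%:Z by rewrite /r; lia.
  by move=> *; rewrite ler_peMl //; lia.
have [b [tau [U [ctau tau0 tauU tauB sep]]]] := marker_function r.
pose B := {ffun 'I_k -> 'I_(b + b.+1)}.
pose rB (j : B) : 'rV[int]_k := cpt j.
have rBex n : sqnorm n <= b%:Z -> exists j, rB j = n.
  move=> nb; have [i|j ->] := @cptP k b n; last by exists j.
  exact: le_trans (sqnorm_coord n i) nb.
pose s (j : B) x : R := (sqnorm (rB j))%:~R + tau (T (rB j) x).
have cs j : continuous (s j).
  move=> x; apply: cvgD; first exact: cvg_cst.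
  by apply: continuous_comp; [exact: cT|exact: ctau].
(* Nonzero exactly when the score of [j] is less than 1 above every other candidate score, and
   continuous in [x]. *)
pose wt (j : B) x : R := \prod_j' Num.max 0 (s j' x + 1 - s j x).
have cwt j : continuous (wt j).
  apply: continuous_prodr => j' _; apply: continuous_maxr; first by move=> x; exact: cvg_cst.
  apply: continuous_subr; last exact: cs.
  by move=> x; apply: cvgD; [exact: cs|exact: cvg_cst].
have wt0 j x : 0 <= wt j x by apply: prodr_ge0 => j' _; rewrite le_max lexx.
have wtP j x : wt j x != 0 -> forall j', s j x < s j' x + 1.
  move=> h j'; rewrite -subr_gt0 ltNge; apply/negP => le.
  by move/negP: h; apply; rewrite /wt (bigD1 j') //= (max_idPl le) mul0r.
have wtex x : exists j, 0 < wt j x.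
  have [n nb _] := tauB x; have [j0 _] := rBex n nb.
  have [j _ hj] := @Order.TotalTheory.arg_minP _ _ _ j0 xpredT (fun j => s j x) isT.
  exists j; apply: prodr_gt0 => j' _; rewrite lt_max; apply/orP; right.
  by have := hj j' isT; lra.
pose W x := \sum_j wt j x.
have W0 x : 0 < W x.
  have [j hj] := wtex x; rewrite /W (bigD1 j) //= ltr_wpDr //.
  by apply: sumr_ge0.
have cW : continuous W by apply: continuous_sumr.
have phP (j : B) (i : 'I_k) : (`|((- rB j ord0 i)%R %% L%:Z)%Z| < L)%N.
  have := modz_ge0 (- rB j ord0 i) (_ : L%:Z != 0); have := ltz_mod (- rB j ord0 i) (_ : L%:Z != 0).
  have Ln : L%:Z != 0 by lia.
  by move=> /(_ Ln) + /(_ Ln); lia.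
(* The site minus its centre is [- rB j]; modulo [L] this is the position of the site in the tiling
   anchored at the centre. *)
pose ph (j : B) : {ffun 'I_k -> 'I_L} := [ffun i => Ordinal (phP j i)].
pose lam p x := \sum_(j | ph j == p) wt j x / W x.
exists lam; split.
- move=> p; apply: continuous_sumr => j _ x; apply: cvgM; first exact: cwt.
  by apply: cvgV; [rewrite gt_eqF|exact: cW].
- by move=> p x; apply: sumr_ge0 => j _; rewrite divr_ge0 // ltW.
- move=> x; have -> : \sum_p lam p x = \sum_j wt j x / W x.
    by rewrite [RHS](partition_big ph xpredT).
  by rewrite -mulr_suml -/(W x) divff // gt_eqF.
(* Only finitely many offsets compete in [wt]. A visit whose offset is out of range has squared
   distance at least [b + 1], and the selected score is below [b + 1]. *)
have nbP x m j : wt j (T m x) != 0 ->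
    near_best [set n | U (T n x)] (fun n => tau (T n x)) m (m + rB j).
  move=> h; have hs := wtP _ _ h.
  have sE j' : s j' (T m x) = (sqnorm (m - (m + rB j')))%:~R + tau (T (m + rB j') x).
    have -> : m - (m + rB j') = - rB j' by rewrite opprD addrA subrr add0r.
    by rewrite /s -TD [rB j' + m]addrC sqnormN.
  have sb : s j (T m x) < b%:R + 1.
    have [n nb t0] := tauB (T m x); have [j0 ej] := rBex n nb.
    apply: (lt_le_trans (hs j0)); rewrite /s ej t0 addr0 lerD2r.
    by rewrite -(ler_int R) in nb.
  split.
    apply: contrapT => nU; move: sb; rewrite sE (tauU _ nU) -subr_gt0.
    have : 0 <= (sqnorm (m - (m + rB j)))%:~R :> R by rewrite ler0z sqnorm_ge0.
    move=> *; lra.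
  move=> n' Un'; rewrite -sE.
  have [le|gt] := lerP (sqnorm (n' - m)) b%:Z.
    have [j' ej] := rBex _ le; have := hs j'.
    have em : m + (n' - m) = n' by rewrite addrC subrK.
    by rewrite (sE j') ej em.
  apply: (lt_le_trans sb); rewrite -[m - n']opprB sqnormN.
  apply: (@le_trans _ _ (sqnorm (n' - m))%:~R); last by rewrite -addrA lerDl addr_ge0.
  have -> : b%:R + 1 = (b%:Z + 1)%:~R :> R by rewrite intrD.
  by rewrite ler_int; lia.
have near_coord x m n : near_best [set n | U (T n x)] (fun n => tau (T n x)) m n ->
    forall i, `|m ord0 i - n ord0 i| <= b%:Z.
  move=> [Un nb] i; have [n0 n0b t0] := tauB (T m x).
  have Un0 : U (T (n0 + m) x).
    apply: contrapT => nU; move: t0; rewrite -TD (tauU _ nU) => /eqP.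
    by rewrite gt_eqF // ltr_wpDl.
  have := nb _ Un0; rewrite TD t0 addr0 => lt.
  have lt2 : (sqnorm (m - n))%:~R < (b%:Z + 1)%:~R :> R.
    apply: (le_lt_trans _ (lt_le_trans lt _)); first by rewrite lerDl tau0.
    by rewrite intrD lerD2r ler_int opprD addrCA subrr addr0 sqnormN.
  rewrite ltr_int in lt2; have := sqnorm_coord (m - n) i; rewrite !mxE.
  by move=> h; apply: (le_trans h); rewrite -ltzD1.
have tex x (a : 'rV[int]_k) : exists n,
    touches [set n | U (T n x)] (fun n => tau (T n x)) L a n.
  have [j hj] := wtex (T a x); exists (a + rB j), a; first by move=> i; rewrite subrr normr0.
  by apply: nbP; rewrite gt_eqF.
have tcoord x (a n : 'rV[int]_k) :
    touches [set n | U (T n x)] (fun n => tau (T n x)) L a n ->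
    forall i, `|a ord0 i - n ord0 i| <= (b + L)%N%:Z.
  by move=> [m am /near_coord h] i; have := am i; have := h i; lia.
(* [e] is the position of [a] in its box of the tiling anchored at the only centre [n] that touches
   [a]. The sites of this box are within [L] of [a], so their near-best centres also touch [a] and
   equal [n]; the bounds on [a] keep the box inside the window. *)
have interior_clean x M (a : {ffun 'I_k -> 'I_M}) :
    (forall i, (L <= a i)%N /\ (a i + L <= M)%N) ->
    a \notin ambiguous [set n | U (T n x)] (fun n => tau (T n x)) L M ->
    a \in clean_sites lam M x.
  move=> ai; rewrite inE => /asboolPn na.
  have [n tn] := tex x (zpt a).
  have uniq n' : touches [set n | U (T n x)] (fun n => tau (T n x)) L (zpt a) n' -> n' = n.
    by move=> tn'; apply/eqP/negPn/negP => ne; apply: na; exists n', n.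
  have Ln : L%:Z != 0 by lia.
  pose e i := (((a i : nat)%:Z - n ord0 i) %% L%:Z)%Z.
  have e0 i : 0 <= e i by exact: modz_ge0.
  have eL i : e i < L%:Z by rewrite /e; have := ltz_mod ((a i : nat)%:Z - n ord0 i) Ln; lia.
  have jP i : (a i - `|e i| < M)%N by rewrite (leq_ltn_trans (leq_subr _ _)).
  have pP i : (`|e i| < L)%N by have := eL i; have := e0 i; lia.
  pose j : {ffun 'I_k -> 'I_M} := [ffun i => Ordinal (jP i)].
  pose p0 : {ffun 'I_k -> 'I_L} := [ffun i => Ordinal (pP i)].
  have jE i : (j i : nat)%:Z = (a i : nat)%:Z - e i.
    by rewrite ffunE /=; have := ai i; have := eL i; have := e0 i; lia.
  rewrite inE; apply/exists_inP; exists j; last first.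
    apply/existsP; exists p0; apply/eqP/rowP => i; rewrite !mxE jE ffunE /=.
    by have := e0 i; lia.
  rewrite inE; apply/asboolP; split.
    by move=> i; have := jE i; have := e0 i; have := ai i; lia.
  move=> p; set m := zpt j + zpt p.
  have am i : `|zpt a ord0 i - m ord0 i| <= L%:Z.
    rewrite !mxE jE; have := eL i; have := e0 i; have := ltn_ord (p i).
    by move: (a i : nat) => u; lia.
  have phe j' : wt j' (T m x) != 0 -> ph j' = p.
    move=> /nbP h; have /rowP en : m + rB j' = n by apply: uniq; exists m.
    apply/ffunP => i; apply/val_inj; rewrite ffunE /=.
    have := en i; rewrite /m mxE [X in X + _]mxE [zpt j _ _]mxE [zpt p _ _]mxE jE.
    change (rB j' 0 i) with (rB j' ord0 i); change (n 0 i) with (n ord0 i).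
    move=> en'; have -> : - rB j' ord0 i =
       (((a i : nat)%:Z - n ord0 i) %/ L%:Z)%Z * L%:Z + (p i : nat)%:Z.
      have := divz_eq ((a i : nat)%:Z - n ord0 i) L%:Z; rewrite -/(e i).
      by move: (_ * L%:Z) => u; lia.
    by rewrite modzMDl modz_small //; have := ltn_ord (p i); lia.
  rewrite /lam -mulr_suml.
  have -> : \sum_(j' | ph j' == p) wt j' (T m x) = W (T m x).
    rewrite /W [RHS](bigID (fun j' => ph j' == p)) /= [X in _ = _ + X]big1 ?addr0 // => j' ne.
    by apply/eqP/negPn/negP => /phe e'; rewrite e' eqxx in ne.
  by rewrite divff // gt_eqF.
have [N0 _ hN0] := pow_ratio_le k (2 * L) c1.
(* [N0 + 2 * L] gives [N0 <= M']; the remaining summands let (q+1)M dominate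
   [q * M + 2 * (b + L) + q]. *)
exists (N0 + 2 * L + (2 * (b + L) + q) + 1)%N => // M /= hM x.
set C := [set n | U (T n x)] in tex tcoord interior_clean *.
have Csep n n' : C n -> C n' -> n != n' -> exists i, r%:Z <= `|n ord0 i - n' ord0 i|.
  exact: sep.
have amb := ambiguous_card q2 r_w r_large Csep (fun a => tex x (zpt a))
  (fun (a : {ffun 'I_k -> 'I_M}) n => @tcoord x (zpt a) n).
set A := ambiguous _ _ _ _ in amb.
pose M' := (M - 2 * L)%N.
have MM' : M = (M' + 2 * L)%N by rewrite /M'; lia.
clearbody M'.
pose I := [set a : {ffun 'I_k -> 'I_M} | [forall i, (L <= a i)%N && (a i + L <= M)%N]]%SET.
have cardI : (M' ^ k <= #|I|)%N.
  have emb (i : 'I_M') : (i + L < M)%N by have := ltn_ord i; have := MM'; lia.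
  pose g (a : {ffun 'I_k -> 'I_M'}) : {ffun 'I_k -> 'I_M} := [ffun i => Ordinal (emb (a i))].
  have gi : injective g.
    move=> a a' /ffunP e; apply/ffunP => i; apply/val_inj.
    by have := congr1 val (e i); rewrite !ffunE /= => /addIn.
  rewrite -card_box -cardsT -(card_imset _ gi); apply: subset_leq_card.
  apply/fintype.subsetP => _ /imsetP[a _ ->]; rewrite inE; apply/forallP => i.
  have gE : nat_of_ord (g a i) = (a i + L)%N by rewrite ffunE.
  rewrite gE; apply/andP; split; first by rewrite leq_addl.
  by have := ltn_ord (a i); have := MM'; lia.
have sub : ~: clean_sites lam M x \subset A :|: ~: I.
  apply/fintype.subsetP => a; rewrite inE => na; rewrite inE [a \in ~: I]inE.
  apply/orP; have [aI|] := boolP (a \in I); last by right.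
  left; apply/negPn/negP => nA; move/negP: na; apply; apply: interior_clean => //.
  by move=> i; move: aI; rewrite inE => /forallP/(_ i)/andP.
have le1 : (#|~: clean_sites lam M x| + M' ^ k <= #|A| + M ^ k)%N.
  have h1 := subset_leq_card sub; have h2 := leq_card_setU A (~: I).
  have h3 := cardsC I; rewrite card_box in h3; move: h2 => [h2 _].
  rewrite -h3 [(#|I| + _)%N]addnC addnA leq_add //.
  exact: leq_trans h1 h2.
have hM' : (N0 <= M')%N by have := MM'; lia.
have le2 : ((M ^ k)%N)%:R <= c * ((M' ^ k)%N)%:R :> R by rewrite {1}MM'; exact: hN0.
have le3 : ((M' ^ k)%N)%:R <= ((M ^ k)%N)%:R :> R.
  by rewrite ler_nat; case: (k) => // k'; rewrite leq_exp2r // MM' leq_addr.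
have le4 : ((M ^ k)%N)%:R + #|A|%:R <= c * ((M ^ k)%N)%:R :> R.
  have q0 : (0:R) < ((q.-1 ^ k)%N)%:R by rewrite ltr0n expn_gt0; lia.
  rewrite -(ler_pM2l q0) -natrD -natrM.
  apply: (@le_trans _ _ (((q.+1 * M) ^ k)%N)%:R).
    rewrite ler_nat; apply: (leq_trans amb).
    case: (k) => // k'; rewrite leq_exp2r //.
    by rewrite mulSn -addnA addnC leq_add2r; lia.
  by rewrite expnMn natrM mulrA ler_wpM2r // mulrC.
have le5 : #|~: clean_sites lam M x|%:R + ((M' ^ k)%N)%:R <= #|A|%:R + ((M ^ k)%N)%:R :> R.
  by rewrite -!natrD ler_nat.
have le6 := ler_wpM2l (ltW th0) le3.
move: le2 le4 le5; rewrite /c !mulrDl !mul1r; lra.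
Qed.

End tower.

(** * The shift metric *)

Lemma sum_uniq_sub (R : numDomainType) (I : eqType) (s s' : seq I) (F : I -> R) :
  (forall i, 0 <= F i) -> uniq s -> uniq s' -> {subset s <= s'} ->
  \sum_(i <- s) F i <= \sum_(i <- s') F i.
Proof.
move=> F0 us us' ss'; rewrite (bigID (fun i => i \in s) _ _ (r := s')) /=.
rewrite -[X in _ <= X + _]big_filter.
have -> : \sum_(i <- [seq i <- s' | i \in s]) F i = \sum_(i <- s) F i.
  apply: perm_big; apply: uniq_perm => //; first exact: filter_uniq.
  by move=> i; rewrite mem_filter andb_idr //; exact: ss'.
by rewrite lerDl sumr_ge0.
Qed.

Section weights.
Variables (R : realType) (k : nat).

Definition zweight (n : 'rV[int]_k) : R := 2 `^ (- zknorm n).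

Lemma zweight_ge0 n : 0 <= zweight n.
Proof. exact: powR_ge0. Qed.

(** The Euclidean norm is at least each |n_i|, hence at least their sum divided by k+1, so the
    weights are dominated by a product of geometric ones; [k.+1] also covers [k = 0]. *)
Let a : R := 2 `^ (- (k.+1%:R)^-1).

Let a_ge0 : 0 <= a. Proof. exact: powR_ge0. Qed.

Let a_lt1 : a < 1.
Proof.
rewrite /a powRN invf_lt1; last by rewrite powR_gt0.
rewrite /powR gt_eqF // expR_gt1 mulr_gt0 ?invr_gt0 ?ltr0n //.
by rewrite ln_gt0 // ltr1n.
Qed.

Lemma zknorm_coord (n : 'rV[int]_k) i : (`|n ord0 i|%N)%:R <= zknorm n :> R.
Proof.
have -> : (`|n ord0 i|%N)%:R = `|(n ord0 i)%:~R| :> R by rewrite natr_absz intr_norm.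
rewrite -sqrtr_sqr /zknorm ler_sqrt; last by apply: sumr_ge0 => j _; rewrite sqr_ge0.
by rewrite (bigD1 i) //= lerDl sumr_ge0 // => j _; rewrite sqr_ge0.
Qed.

Lemma zweight_le n : zweight n <= \prod_(i < k) a ^+ `|n ord0 i|%N.
Proof.
rewrite prodrXr -powR_mulrn // /a -powRrM /zweight; apply: ler_powR; first by rewrite ler1n.
rewrite mulNr lerN2 mulrC ler_pdivrMr ?ltr0n // natr_sum.
apply: (@le_trans _ _ (\sum_(i < k) zknorm n)).
  by apply: ler_sum => i _; exact: zknorm_coord.
rewrite sumr_const card_ord -[leLHS]mulr_natr ler_wpM2l ?ler_nat //.
exact: sqrtr_ge0.
Qed.

Let geo m : \sum_(l < m) a ^+ l <= (1 - a)^-1.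
Proof.
have a1 : 0 < 1 - a by rewrite subr_gt0.
rewrite -[leRHS]mul1r ler_pdivlMr //.
have -> : (\sum_(l < m) a ^+ l) * (1 - a) = 1 - a ^+ m.
  by rewrite mulrC -[1 - a]opprB mulNr -subrX1 opprB.
by rewrite gerBl exprn_ge0.
Qed.

Lemma zweight_box b : \sum_(j : {ffun 'I_k -> 'I_(b + b.+1)}) zweight (cpt j) <=
  (2 / (1 - a)) ^+ k.
Proof.
apply: (@le_trans _ _ (\prod_(i < k) \sum_(l < b + b.+1) a ^+ `|l%:Z - b%:Z|%N)).
  rewrite bigA_distr_bigA /=; apply: ler_sum => j _; apply: (le_trans (zweight_le _)).
  by rewrite le_eqVlt; apply/orP; left; apply/eqP; apply: eq_bigr => i _; rewrite !mxE.
rewrite -[X in _ ^+ X](card_ord k) -prodr_const; apply: ler_prod => i _.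
apply/andP; split; first by apply: sumr_ge0 => l _; rewrite exprn_ge0.
rewrite big_split_ord /= mulr_natl mulr2n; apply: lerD.
  rewrite (reindex_inj rev_ord_inj) /=; apply: le_trans (geo b).
  apply: ler_sum => l _.
  have -> : `|((b - l.+1)%N%:Z - b%:Z)%R|%N = l.+1 by have := ltn_ord l; lia.
  by rewrite exprS ger_pMl ?ltW // exprn_gt0 // powR_gt0.
apply: le_trans (geo b.+1); apply: ler_sum => l _.
by have -> : `|((b + l)%N%:Z - b%:Z)%R|%N = l by lia.
Qed.

Lemma finite_in_box (A : set 'rV[int]_k) : finite_set A ->
  exists b : nat, forall n, A n -> forall i, `|n ord0 i| <= b%:Z.
Proof.
move=> /finite_seqP[s ->]; exists (\sum_(n <- s) \sum_(i < k) `|n ord0 i|%N)%N => n /= ns i.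
rewrite (big_rem n ns) /= (bigD1 i) //= -addnA PoszD abszE lerDl //.
Qed.

Lemma esum_zweight_lty : (\esum_(n in [set: 'rV[int]_k]) (zweight n)%:E < +oo)%E.
Proof.
apply: (@le_lt_trans _ _ ((2 / (1 - a)) ^+ k)%:E); last exact: ltry.
apply: ge_ereal_sup => _ [A [fA _] <-].
rewrite fsumEFin // lee_fin fsbig_finite //=.
have [b hb] := finite_in_box fA.
apply: le_trans (zweight_box b).
rewrite -[leRHS]big_enum -(big_map (@cpt k b) xpredT zweight).
apply: sum_uniq_sub; [exact: zweight_ge0|exact: finmap.fset_uniq| |].
  by rewrite map_inj_uniq ?enum_uniq //; exact: cpt_inj.
move=> n; rewrite in_fset_set // inE => /hb /cptP[j ->].
by apply/mapP; exists j; rewrite ?mem_enum.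
Qed.

Definition zmass : R := fine (\esum_(n in [set: 'rV[int]_k]) (zweight n)%:E).

Lemma zmassE : (\esum_(n in [set: 'rV[int]_k]) (zweight n)%:E = zmass%:E)%E.
Proof.
rewrite /zmass fineK // ge0_fin_numE; first exact: esum_zweight_lty.
by apply: esum_ge0 => n _; rewrite lee_fin zweight_ge0.
Qed.

Lemma zmass_ge0 : 0 <= zmass.
Proof.
by rewrite -lee_fin -zmassE; apply: esum_ge0 => n _; rewrite lee_fin zweight_ge0.
Qed.

Lemma esum_scale_le (A : set 'rV[int]_k) (c : R) : 0 <= c ->
  (\esum_(n in A) (zweight n * c)%:E <= c%:E * \esum_(n in A) (zweight n)%:E)%E.
Proof.
move=> c0; apply: ge_ereal_sup => _ [B [fB BA] <-].
apply: (@le_trans _ _ (c%:E * \sum_(n \in B) (zweight n)%:E)%E).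
  rewrite ge0_mule_fsumr; last by move=> n; rewrite lee_fin zweight_ge0.
  rewrite le_eqVlt; apply/orP; left; apply/eqP; apply: eq_fsbigr => n _.
  by rewrite mulrC EFinM.
apply: lee_wpmul2l; first by rewrite lee_fin.
by apply: ereal_sup_ubound; exists B.
Qed.

Lemma zweight_tail (e : R) : 0 < e -> exists b : nat,
  (\esum_(n in ~` [set n : 'rV[int]_k | forall i, (`|n ord0 i| <= b%:Z)%R]) (zweight n)%:E <= e%:E)%E.
Proof.
move=> e0; have fin : (\esum_(n in [set: 'rV[int]_k]) (zweight n)%:E)%E \is a fin_num by rewrite zmassE.
have [_ [A [fA _] <-] lt] := ub_ereal_sup_adherent e0 fin.
have [b hb] := finite_in_box fA; exists b.
set B := [set n | _].
have w0 n : (0 <= (zweight n)%:E)%E by rewrite lee_fin zweight_ge0.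
have := @esumID R _ B setT (fun n => (zweight n)%:E) (fun n _ => w0 n).
rewrite !setTI => eq.
have leA : (\sum_(n \in A) (zweight n)%:E <= \esum_(n in B) (zweight n)%:E)%E.
  by apply: ereal_sup_ubound; exists A => //; split => // n /hb.
have B0 : (0 <= \esum_(n in B) (zweight n)%:E)%E by apply: esum_ge0.
have C0 : (0 <= \esum_(n in ~` B) (zweight n)%:E)%E by apply: esum_ge0.
move: lt; rewrite -/(esum _ _) zmassE.
move: eq leA B0 C0; rewrite zmassE.
have -> : (\sum_(n \in A) (zweight n)%:E)%E = (\sum_(n \in A) zweight n)%:E by rewrite fsumEFin.
case: (\esum_(n in B) _)%E => [u| |] //; case: (\esum_(n in ~` B) _)%E => [v| |] //.
by rewrite -EFinD -EFinB !lee_fin lte_fin => -[->] *; lra.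
Qed.

End weights.

Section Dshift_theory.
Variables (R : realType) (k : nat) (V : normedModType R).
Implicit Types (x y z : 'rV[int]_k -> V) (c : R).

Let term x y n : \bar R := (zweight R n * `|x n - y n|)%:E.

Let term_ge0 x y n : (0 <= term x y n)%E.
Proof. by rewrite lee_fin mulr_ge0 ?zweight_ge0. Qed.

Let esum_term_le (A : set 'rV[int]_k) x y c : 0 <= c ->
  (forall n, A n -> `|x n - y n| <= c) ->
  (\esum_(n in A) term x y n <= c%:E * \esum_(n in A) (zweight R n)%:E)%E.
Proof.
move=> c0 h; apply: le_trans (esum_scale_le _ c0); apply: le_esum => n An.
by rewrite lee_fin ler_wpM2l ?zweight_ge0 // h.
Qed.

Lemma Dshift_ge0 x y : 0 <= Dshift x y.
Proof. by apply: fine_ge0; apply: esum_ge0 => n _; exact: term_ge0. Qed.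

Lemma DshiftC x y : Dshift x y = Dshift y x.
Proof. by congr fine; apply: eq_esum => n _; rewrite distrC. Qed.

(** [fine] would turn an infinite sum into 0, so every estimate on [Dshift] first secures finiteness
    from a uniform bound on the coordinates. *)
Lemma Dshift_fin x y c : 0 <= c -> (forall n, `|x n - y n| <= c) ->
  (\esum_(n in [set: 'rV[int]_k]) term x y n = (Dshift x y)%:E)%E.
Proof.
move=> c0 h; rewrite /Dshift fineK //.
rewrite ge0_fin_numE; last by apply: esum_ge0 => n _; exact: term_ge0.
apply: le_lt_trans (esum_term_le c0 (fun n _ => h n)) _.
by rewrite zmassE -EFinM ltry.
Qed.

Lemma Dshift_le x y c : 0 <= c -> (forall n, `|x n - y n| <= c) ->
  Dshift x y <= c * zmass R k.
Proof.
move=> c0 h; rewrite -lee_fin -(Dshift_fin c0 h).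
by apply: le_trans (esum_term_le c0 (fun n _ => h n)) _; rewrite zmassE EFinM.
Qed.

Lemma Dshift_triangle x y z c : 0 <= c ->
  (forall n, `|x n - y n| <= c) -> (forall n, `|y n - z n| <= c) ->
  Dshift x z <= Dshift x y + Dshift y z.
Proof.
move=> c0 hxy hyz; have hxz n : `|x n - z n| <= c + c.
  by apply: (le_trans (ler_distD (y n) _ _)); rewrite lerD.
rewrite -lee_fin EFinD -(Dshift_fin (addr_ge0 c0 c0) hxz) -(Dshift_fin c0 hxy).
rewrite -(Dshift_fin c0 hyz) -esumD; [|by move=> *; exact: term_ge0..].
apply: le_esum => n _; rewrite -EFinD lee_fin -mulrDr.
by rewrite ler_wpM2l ?zweight_ge0 // ler_distD.
Qed.

Lemma Dshift_window x y (c d t : R) (b : nat) : 0 <= c -> 0 <= d ->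
  (\esum_(n in ~` [set n : 'rV[int]_k | forall i, (`|n ord0 i| <= b%:Z)%R]) (zweight R n)%:E <= t%:E)%E ->
  (forall n : 'rV[int]_k, (forall i, `|n ord0 i| <= b%:Z) -> `|x n - y n| <= c) ->
  (forall n, `|x n - y n| <= d) ->
  Dshift x y <= c * zmass R k + d * t.
Proof.
move=> c0 d0 ht hc hd; rewrite -lee_fin -(Dshift_fin d0 hd).
rewrite (@esumID R _ [set n : 'rV[int]_k | forall i, (`|n ord0 i| <= b%:Z)%R]); last first.
  by move=> n _; exact: term_ge0.
rewrite !setTI EFinD; apply: leeD.
  apply: (le_trans (esum_term_le c0 hc)); rewrite EFinM -zmassE.
  apply: lee_wpmul2l; first by rewrite lee_fin.
  rewrite [leRHS](@esumID R _ [set n : 'rV[int]_k | forall i, (`|n ord0 i| <= b%:Z)%R]).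
    by rewrite !setTI leeDl //; apply: esum_ge0 => n _; rewrite lee_fin zweight_ge0.
  by move=> n _; rewrite lee_fin zweight_ge0.
apply: (le_trans (esum_term_le d0 (fun n _ => hd n))); rewrite EFinM.
by apply: lee_wpmul2l; rewrite ?lee_fin.
Qed.

End Dshift_theory.

(** * Coverings by labels *)

Section sup_dist_theory.
Variables (R : realType) (V : normedModType R) (X : topologicalType).

Lemma sup_distP (K : set V) (d : R) (f g : X -> V) :
  (forall u v, K u -> K v -> `|u - v| <= d) -> CXK K f -> CXK K g ->
  forall x, `|f x - g x| <= sup_dist f g.
Proof.
move=> Kd [_ Kf] [_ Kg] x; apply: ub_le_sup; last by exists x.
by exists d => _ [y _ <-]; exact: Kd.
Qed.

Lemma sup_dist_le (f g : X -> V) c : 0 <= c -> (forall x, `|f x - g x| <= c) ->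
  sup_dist f g <= c.
Proof.
move=> c0 h; rewrite /sup_dist; set E := (X in sup X).
have [E0|/set0P/negP/negPn/eqP ->] := pselect (E !=set0); last by rewrite sup0.
by apply: ge_sup => // _ [x _ <-].
Qed.

End sup_dist_theory.

Section labels.
Variables (R : realType) (V : normedModType R) (K : set V).
Variables (k : nat) (X : metricType R) (T : 'rV[int]_k -> X -> X).
Hypothesis aT : is_Zk_action T.
Variable d : R.
Hypothesis d0 : 0 <= d.
Hypothesis Kd : forall u v, K u -> K v -> `|u - v| <= d.

Lemma zshift_Imap (f : X -> V) n x : zshift n (Imap T f x) = Imap T f (T n x).
Proof.
have [_ [TD _]] := aT.
by apply/funext => m; rewrite /zshift /Imap TD.
Qed.

Lemma Imap_bounded f x y : CXK K f -> forall n, `|Imap T f x n - Imap T f y n| <= d.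
Proof. by move=> [_ Kf] n; apply: Kd; exact: Kf. Qed.

(** A partition of the orbit segments in place of an open cover: no continuity is asked of [l], and
    equality of labels iterates over translated windows. *)
Definition labels (f : X -> V) (e : R) (N p : nat) :=
  exists (I : finType) (l : X -> I), (#|I| <= p)%N /\
    forall x y, l x = l y -> forall m, zbox k N m ->
      Dshift (Imap T f (T m x)) (Imap T f (T m y)) <= e.

Lemma labels_sub f e N p J M : (0 < N)%N -> (M <= J * N)%N ->
  labels f e N p -> labels f e M (p ^ (J ^ k)).
Proof.
move=> N0 MJ [I [l [Ip hl]]]; have [_ [TD _]] := aT.
exists {ffun {ffun 'I_k -> 'I_J} -> I}, (fun x => [ffun j => l (T (zpt j *+ N) x)]).
split.
  rewrite card_ffun card_box; case: (J ^ k)%N => // n.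
  by rewrite leq_exp2r.
move=> x y /ffunP e1 m /(zbox_cover N0 MJ)[j [n [bn ->]]].
by rewrite !TD; apply: hl => //; have := e1 j; rewrite !ffunE.
Qed.

Let dd M := dyn_dist (@zshift k V) (@Dshift R k V) (zbox k M).

Let ddP f M x y c : 0 <= c ->
  dd M (Imap T f x) (Imap T f y) <= c <->
  forall n, zbox k M n -> Dshift (Imap T f (T n x)) (Imap T f (T n y)) <= c.
Proof.
move=> c0; rewrite (dyn_dist_leP (@zshift k V) M); [|exact: Dshift_ge0|by []].
by split=> h n bn; have := h n bn; rewrite !zshift_Imap.
Qed.

Let dd_ge0 M x y : 0 <= dd M x y.
Proof.
rewrite /dd /dyn_dist; set E := (X in sup X).
have [hs|/sup_out ->//] := pselect (has_sup E).
have [[w [n bn ew]] ub] := hs.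
apply: le_trans (Dshift_ge0 (zshift n x) (zshift n y)) _.
by apply: ub_le_sup => //; exists n.
Qed.

Let dd_triangle f M x y z : CXK K f ->
  dd M (Imap T f x) (Imap T f z) <= dd M (Imap T f x) (Imap T f y) + dd M (Imap T f y) (Imap T f z).
Proof.
move=> cf; apply/ddP => [|n bn]; first by rewrite addr_ge0.
apply: le_trans (Dshift_triangle d0 (Imap_bounded _ (T n y) cf) (Imap_bounded _ _ cf)) _.
by apply: lerD; [move: n bn|move: n bn]; apply/ddP.
Qed.

Let ddC f M x y : dd M (Imap T f x) (Imap T f y) = dd M (Imap T f y) (Imap T f x).
Proof.
by apply/eqP; rewrite eq_le; apply/andP; split; apply/ddP => // n bn;
  rewrite DshiftC; move: n bn; apply/ddP.
Qed.

Let dd0 f M x : CXK K f -> dd M (Imap T f x) (Imap T f x) = 0.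
Proof.
move=> cf; apply/eqP; rewrite eq_le dd_ge0 andbT; apply/ddP => // n _.
apply: le_trans (Dshift_le (lexx 0) _) _; last by rewrite mul0r.
by move=> m; rewrite subrr normr0.
Qed.

Lemma cover_num_labels f e eps M p : CXK K f -> 0 <= e -> e < eps -> labels f e M p ->
  cover_num (range (Imap T f)) eps (dd M) <= p%:R.
Proof.
move=> cf e0 ee [I [l [Ip hl]]].
apply: (@le_trans _ _ #|I|%:R); last by rewrite ler_nat.
apply: ge_inf; first by exists 0 => _ [n _ <-].
exists #|I| => //.
(* The classes are thickened by [t] to become open; their diameter [t + e + t] stays below [eps]. *)
pose t := (eps - e) / 4; have t0 : 0 < t by rewrite divr_gt0 ?subr_gt0.
pose U (i : 'I_#|I|) := [set z | range (Imap T f) z /\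
   exists2 x, l x = enum_val i & dd M z (Imap T f x) < t].
exists U; split; last first.
  move=> z [x _ <-]; exists (enum_rank (l x)) => //; split; first by exists x.
  by exists x; [rewrite enum_rankK|rewrite dd0].
move=> i; split.
  split; first by move=> z [].
  move=> y [[u _ <-] [x lx yx]]; exists (t - dd M (Imap T f u) (Imap T f x)).
    by rewrite subr_gt0.
  move=> z [[v _ <-] uv]; split; first by exists v.
  exists x => //; apply: le_lt_trans (dd_triangle M v u x cf) _.
  by rewrite (ddC f M v u) -ltrBrDr.
apply: (@le_lt_trans _ _ (t + e + t)%:E); last by rewrite lte_fin /t; lra.
apply: ge_ereal_sup => _ [[z z'] [/= [[u _ <-] [x lx ux]] [[v _ <-] [y ly vy]]] <-].
rewrite lee_fin; apply: le_trans (dd_triangle M u x v cf) _.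
rewrite -addrA lerD ?(ltW ux) //; apply: le_trans (dd_triangle M x y v cf) _.
rewrite lerD //; last by rewrite ddC ltW.
by apply/ddP => //; apply: hl; rewrite lx ly.
Qed.

Lemma ln_nat_ge0 (n : nat) : 0 <= ln (n%:R : R).
Proof. by case: n => [|n]; [rewrite ln0|apply: ln_ge0; rewrite ler1n]. Qed.

Lemma ln_natX (n m : nat) : ln (((n ^ m)%N)%:R : R) = m%:R * ln (n%:R : R).
Proof.
case: n => [|n]; last by rewrite natrX lnXn ?ltr0n // mulr_natl.
case: m => [|m]; first by rewrite expn0 ln1 mul0r.
by rewrite exp0n // ln0 // mulr0.
Qed.

Lemma S_entropy_labels f e eps N p : CXK K f -> 0 <= e -> e < eps -> (0 < N)%N ->
  labels f e N p ->
  (S_entropy (@zshift k V) (range (Imap T f)) eps (@Dshift R k V) <=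
    (ln (p%:R : R) / ((N ^ k)%N)%:R)%:E)%E.
Proof.
move=> cf e0 ee N0 lab; rewrite /S_entropy.
pose v M := ln (cover_num (range (Imap T f)) eps (dd M)).
have vsub J M : (M <= J * N)%N -> v M <= ((J ^ k)%N)%:R * ln (p%:R : R).
  move=> MJ; rewrite -ln_natX.
  have le := cover_num_labels cf e0 ee (labels_sub N0 MJ lab).
  (* [ln] is 0 at a cover number 0, the value for an empty space. *)
  have [c0|c0] := lerP (cover_num (range (Imap T f)) eps (dd M)) 0.
    by rewrite /v ln0 // ln_nat_ge0.
  by rewrite /v ler_ln // posrE // (lt_le_trans c0).
set t := ln _ / _.
have t0 : 0 <= t by rewrite divr_ge0 // ln_nat_ge0.
(* In the divergent case [limn] is the default point 0, below the nonnegative [t]. *)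
have [cv|ncv] := pselect (cvgn (fun M => (v M / ((M ^ k)%N)%:R)%:E)); last first.
  by rewrite (dvgP ncv) lee_fin.
apply/lee_addgt0Pr => c c0; apply: lime_le => //.
have tc : t < t + c by rewrite ltrDl.
have := fekete_lt (ln_nat_ge0 p) N0 vsub tc.
by apply: filterS => M h; rewrite -EFinD lee_fin ltW.
Qed.

(** Openness comes from the gap [e < eps]: a nearby function keeps [N], [p] and the labelling, and
    only [e] moves to the midpoint. *)
Definition low_entropy (f : X -> V) (del a : R) := exists eps e N p,
  [/\ 0 < eps < del, 0 <= e < eps, (0 < N)%N, labels f e N p &
      ln (p%:R : R) < a * ((N ^ k)%N)%:R * `|ln eps|].

Lemma metric_mdim_le f (m : R) : CXK K f ->
  (forall n : nat, low_entropy f n.+1%:R^-1 (m + n.+1%:R^-1)) ->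
  (metric_mdim (@zshift k V) (range (Imap T f)) (@Dshift R k V) <= m%:E)%E.
Proof.
move=> cf hg; apply: ge_ereal_sup => _ [del /= del0 <-].
apply/lee_addgt0Pr => c c0.
near \oo => n.
have nlt (r : R) : 0 < r -> r^-1 < n%:R -> n.+1%:R^-1 < r.
  move=> r0 h; rewrite invf_plt ?posrE ?ltr0n // (lt_trans h) //.
  by rewrite ltr_nat.
have ndel : n.+1%:R^-1 < del by apply: nlt => //; near: n; exact: nbhs_infty_gtr.
have nc : n.+1%:R^-1 < c by apply: nlt => //; near: n; exact: nbhs_infty_gtr.
have [eps [e [N [p [/andP[eps0 epsn] /andP[e0 ee] N0 lab hp]]]]] := hg n.
have eps1 : eps < 1 by apply: (lt_le_trans epsn); rewrite invf_le1 ?ler1n ?ltr0n.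
have ln0' : 0 < `|ln eps| by rewrite normr_gt0 lt_eqF // ln_lt0 // eps0.
have Nk : (0:R) < ((N ^ k)%N)%:R by rewrite ltr0n expn_gt0 N0.
apply: (@le_trans _ _ (S_entropy (@zshift k V) (range (Imap T f)) eps (@Dshift R k V) *
   (`|ln eps|^-1)%:E)%E).
  by apply: ereal_inf_lbound; exists eps => //=; rewrite eps0 (lt_trans epsn).
apply: (@le_trans _ _ ((ln (p%:R : R) / ((N ^ k)%N)%:R)%:E * (`|ln eps|^-1)%:E)%E).
  by apply: lee_wpmul2r; [rewrite lee_fin invr_ge0|exact: S_entropy_labels ee N0 lab].
rewrite -EFinM -EFinD lee_fin ler_pdivrMr // ler_pdivrMr // ltW //.
apply: (lt_le_trans hp); rewrite -mulrA [X in _ * X]mulrC mulrA.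
by rewrite !ler_wpM2r ?(ltW Nk) ?(ltW ln0') // lerD2l ltW.
Unshelve. all: by end_near. Qed.

Lemma low_entropy_open f del a : CXK K f -> low_entropy f del a ->
  exists2 r, 0 < r & forall g, CXK K g -> sup_dist f g < r -> low_entropy g del a.
Proof.
move=> cf [eps [e [N [p [h1 /andP[e0 ee] N0 [I [l [Ip hl]]] h2]]]]].
have Z0 := zmass_ge0 R k.
(* Changing the function by [r] moves each of the two points by at most [(eps - e) / 4], so [e]
   grows to at most [(e + eps) / 2]. *)
pose r := (eps - e) / (4 * (zmass R k + 1)).
have r0 : 0 < r by rewrite divr_gt0 ?subr_gt0 // mulr_gt0 // ltr_wpDl.
have rZ : r * zmass R k <= (eps - e) / 4.
  rewrite /r invfM mulrA -mulrA ler_piMr ?divr_ge0 ?subr_ge0 ?(ltW ee) //.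
  by rewrite mulrC ler_pdivrMr ?ltr_wpDl // mul1r lerDl.
exists r => // g cg fg; exists eps, ((e + eps) / 2), N, p; split => //; first by apply/andP; split; lra.
exists I, l; split => // x y lxy m bm.
have near_fg z : Dshift (Imap T g z) (Imap T f z) <= (eps - e) / 4.
  apply: le_trans rZ; apply: Dshift_le; first exact: ltW.
  by move=> n; rewrite distrC; apply: le_trans (ltW fg); exact: (sup_distP Kd).
have bgf u v n : `|Imap T g u n - Imap T f v n| <= d by apply: Kd; [apply cg|apply cf].
have bfg u v n : `|Imap T f u n - Imap T g v n| <= d by apply: Kd; [apply cf|apply cg].
have := hl x y lxy m bm; have := near_fg (T m x); have := near_fg (T m y).
have := Dshift_triangle d0 (bgf (T m x) (T m x)) (bfg (T m x) (T m y)).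
have := Dshift_triangle d0 (Imap_bounded (T m x) (T m y) cf) (bfg (T m y) (T m y)).
rewrite (DshiftC (Imap T f (T m y)) (Imap T g (T m y))).
lra.
Qed.

End labels.

(** * Baire category in C(X,K) *)

Section baire.
Variables (R : realType) (V : completeNormedModType R) (K : set V) (X : topologicalType).
Hypothesis closedK : closed K.
Variable d : R.
Hypothesis Kd : forall u v, K u -> K v -> `|u - v| <= d.

Lemma CXK_complete (f : nat -> X -> V) (r : nat -> R) :
  (forall n, CXK K (f n)) ->
  (forall e, 0 < e -> exists n, r n < e) ->
  (forall n m x, (n <= m)%N -> `|f n x - f m x| <= r n) ->
  exists2 h, CXK K h & forall n x, `|f n x - h x| <= r n.
Proof.
move=> cf r0 fr.
have cv x : cvgn (fun n => f n x).
  apply: cauchy_cvg; apply: cauchy_exP => e e0; have [n rn] := r0 e e0.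
  exists (f n x); exists n => // m /= nm.
  by rewrite -ball_normE /=; apply: le_lt_trans rn; exact: fr.
pose h x := limn (fun n => f n x).
have fh n x : `|f n x - h x| <= r n.
  have cvx : (fun m => `|f n x - f m x|) @ \oo --> `|f n x - h x|.
    by apply: cvg_norm; apply: cvgB; [exact: cvg_cst|exact: cv].
  rewrite -(cvg_lim _ cvx) //; apply: limr_le; first by apply/cvg_ex; eexists; exact: cvx.
  by exists n => // m /= nm; exact: fr.
exists h => //; split.
  move=> x; apply/cvgrPdist_lt => e e0.
  have [n rn] := r0 (e / 3) (divr_gt0 e0 (ltr0n _ 3)).
  have [cn _] := cf n; have /cvgrPdist_lt/(_ (e / 3)) := cn x.
  move=> /(_ (divr_gt0 e0 (ltr0n _ 3))); apply: filterS => y fxy.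
  have h1 := fh n x; have h2 := fh n y; rewrite distrC in h1.
  apply: le_lt_trans (ler_distD (f n x) _ _) _.
  have := ler_distD (f n y) (f n x) (h y).
  by move: h1 h2 rn fxy; lra.
move=> x; apply: (@closed_cvg _ _ \oo _ (fun n => f n x) K) => //.
  by apply: nearW => n; apply cf.
Qed.

(** Nested closed balls by dependent choice on triples (stage, centre, radius). Radii at least halve
    and centres move by at most half a radius, so each limit stays in all the balls. *)
Lemma CXK_baire (U : nat -> set (X -> V)) :
  (forall j f, CXK K f -> U j f -> exists2 r, 0 < r &
     forall g, CXK K g -> sup_dist f g < r -> U j g) ->
  (forall j f e, CXK K f -> 0 < e -> exists g, [/\ CXK K g, U j g & sup_dist f g < e]) ->
  forall f e, CXK K f -> 0 < e ->
    exists g, [/\ CXK K g, forall j, U j g & sup_dist f g < e].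
Proof.
move=> oU dU f e cf e0.
pose St := {s : nat * ((X -> V) * R) | CXK K s.2.1 /\ 0 < s.2.2}.
pose Step (s s' : St) := [/\ (sval s').1 = (sval s).1.+1, (sval s').2.2 <= (sval s).2.2 / 2,
  sup_dist (sval s).2.1 (sval s').2.1 <= (sval s).2.2 / 2 &
  forall h, CXK K h -> sup_dist (sval s').2.1 h <= (sval s').2.2 -> U (sval s).1 h].
have step s : {s' | Step s s'}.
  apply: cid; case: s => -[j [g r]] [/= cg r0].
  have [g' [cg' Ug' gg']] := dU j g (r / 2) cg (divr_gt0 r0 (ltr0n _ 2)).
  have [r1 r10 hr1] := oU j g' cg' Ug'.
  have p : CXK K g' /\ 0 < Num.min (r1 / 2) (r / 2).
    by split => //; rewrite lt_min !divr_gt0.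
  exists (exist _ (j.+1, (g', Num.min (r1 / 2) (r / 2))) p); split => //=.
  - by rewrite ge_min lexx orbT.
  - exact: ltW.
  - move=> h ch gh; apply: hr1 => //; apply: (le_lt_trans gh).
    by rewrite gt_min ltr_pdivrMr // ltr_pMr // ltr1n.
have p0 : CXK K f /\ 0 < e / 2 by split => //; rewrite divr_gt0.
have [s [s0 sS]] := dependent_choice step (exist _ (0%N, (f, e / 2)) p0).
pose F n := (sval (s n)).2.1; pose r n := (sval (s n)).2.2.
have cF n : CXK K (F n) by have [] := svalP (s n).
have r0 n : 0 < r n by have [] := svalP (s n).
have jn n : (sval (s n)).1 = n.
  by elim: n => [|n IH]; [rewrite s0|have [-> _ _ _] := sS n; rewrite IH].
have rS n : r n.+1 <= r n / 2 by have [] := sS n.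
have FS n x : `|F n x - F n.+1 x| <= r n / 2.
  by have [_ _ h _] := sS n; apply: le_trans h; exact: (sup_distP Kd).
(* Halving beats linear growth; the decay 1/(n+1) obtained here is enough for the radii to tend to
   0. *)
have rn n : r n * n.+1%:R <= e / 2.
  elim: n => [|n IH]; first by rewrite mulr1 /r s0.
  apply: le_trans IH; apply: le_trans (ler_wpM2r _ (rS n)) _ => //.
  rewrite -mulrA ler_wpM2l ?(ltW (r0 n)) // mulrC ler_pdivrMr // -natrM ler_nat; lia.
have Fr n m x : (n <= m)%N -> `|F n x - F m x| <= r n.
  move=> nm; apply: (@le_trans _ _ (r n - r m)); last by rewrite gerBl ltW.
  rewrite -(subnKC nm); elim: (m - n)%N => [|i IH]; first by rewrite addn0 !subrr normr0.
  rewrite addnS; apply: le_trans (ler_distD (F (n + i)%N x) _ _) _.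
  by have := FS (n + i)%N x; have := rS (n + i)%N; move: IH; lra.
have rsmall c : 0 < c -> exists n, r n < c.
  move=> c0; near \oo => n; exists n.
  have h : e / 2 / c < n%:R by near: n; exact: nbhs_infty_gtr.
  rewrite ltr_pdivrMr // in h; rewrite -(ltr_pM2r (ltr0Sn R n)).
  apply: le_lt_trans (rn n) _; apply: (lt_trans h); rewrite mulrC ltr_pM2l //.
  by rewrite ltr_nat.
have [h ch Fh] := CXK_complete cF rsmall Fr.
exists h; split => // [j|].
  have [_ _ _ /(_ h ch)] := sS j; rewrite jn; apply.
  by apply: sup_dist_le; [exact/ltW/r0|move=> x; exact: Fh].
apply: (@le_lt_trans _ _ (e / 2)); last by rewrite ltr_pdivrMr // ltr_pMr // ltr1n.
apply: sup_dist_le; first by rewrite ltW // divr_gt0.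
by move=> x; have := Fh 0%N x; rewrite /F /r s0.
Unshelve. all: by end_near. Qed.

End baire.

(** * Finite-dimensional approximation *)

Section grids.
Variable R : realType.

(** On [0,1] the cell of index [q] is met only at [t = 1], hence [q.+1] cells. *)
Definition grid q (t : R) : 'I_q.+1 := inord (Num.truncn (t * q%:R)).

Lemma grid_close q (t t' : R) : (0 < q)%N -> 0 <= t <= 1 -> 0 <= t' <= 1 ->
  grid q t = grid q t' -> `|t - t'| <= q%:R^-1.
Proof.
move=> q0 ht ht' /(congr1 val) /=.
have Q0 : (0 : R) < q%:R by rewrite ltr0n.
have bnd (u : R) : 0 <= u <= 1 -> (Num.truncn (u * q%:R) < q.+1)%N /\
    (Num.truncn (u * q%:R))%:R <= u * q%:R < (Num.truncn (u * q%:R)).+1%:R.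
  move=> /andP[u0 u1]; have h := truncn_itv (mulr_ge0 u0 (ler0n R q)); split => //.
  rewrite ltnS -(ler_nat R); have /andP[h1 _] := h; apply: (le_trans h1).
  by rewrite ler_piMl.
have [h1 /andP[a1 b1]] := bnd t ht; have [h2 /andP[a2 b2]] := bnd t' ht'.
rewrite !inordK // => e; rewrite e in a1 b1.
rewrite -(ler_pM2r Q0) mulVf ?gt_eqF // -[X in _ * X](gtr0_norm Q0) -normrM mulrBl.
rewrite ler_norml; move: a1 b1 a2 b2; rewrite -natr1 => *.
by apply/andP; split; lra.
Qed.

Definition l1 m (t t' : 'rV[R]_m) : R := \sum_i `|t ord0 i - t' ord0 i|.

Lemma l1_ge0 m (t t' : 'rV[R]_m) : 0 <= l1 t t'.
Proof. by apply: sumr_ge0. Qed.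

Lemma l1_eq0 m (t t' : 'rV[R]_m) : l1 t t' = 0 -> t = t'.
Proof.
move/eqP; rewrite psumr_eq0 // => /allP h; apply/rowP => i.
have := h i; rewrite mem_index_enum => /(_ isT) /=.
by rewrite normr_eq0 subr_eq0 => /eqP.
Qed.

Lemma l1C m (t t' : 'rV[R]_m) : l1 t t' = l1 t' t.
Proof. by apply: eq_bigr => i _; rewrite distrC. Qed.

Lemma l1_triangle m (t u v : 'rV[R]_m) : l1 t v <= l1 t u + l1 u v.
Proof. by rewrite -big_split; apply: ler_sum => i _; exact: ler_distD. Qed.

Lemma continuous_l1 (X : topologicalType) m (pi pi' : X -> 'rV[R]_m) :
  continuous pi -> continuous pi' -> continuous (fun x => l1 (pi x) (pi' x)).
Proof.
move=> cpi cpi'; apply: continuous_sumr => i _ x; apply: cvg_norm; apply: cvgB.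
  apply: (@continuous_comp X 'rV[R]_m R pi (fun M => M ord0 i)); first exact: cpi.
  exact: coord_continuous.
apply: (@continuous_comp X 'rV[R]_m R pi' (fun M => M ord0 i)); first exact: cpi'.
exact: coord_continuous.
Qed.

(* One barycentric coordinate of a simplex is determined by the others, so a point of a
   D-dimensional complex is located up to O(1/q) by its support and D coordinates. *)
Definition realization_label m D q (t : 'rV[R]_m) : {set 'I_m} * {ffun 'I_D -> 'I_q.+1} :=
  let s := [set i | t ord0 i != 0]%SET in
  (s, if enum s is i0 :: e then [ffun r : 'I_D => grid q (t ord0 (nth i0 e r))]
      else [ffun => ord0]).

Lemma realization_label_close m (S : {set {set 'I_m}}) q (t t' : 'rV[R]_m) :
  (0 < q)%N -> is_simplicial_complex S -> realization S t -> realization S t' ->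
  realization_label (complex_dim S) q t = realization_label (complex_dim S) q t' ->
  l1 t t' <= (2 * m)%N%:R / q%:R.
Proof.
move=> q0 [Sn _] [t0 [t1 tS]] [t0' [t1' tS']] [es].
have itv (u : 'rV[R]_m) i : (forall i, 0 <= u ord0 i) -> \sum_i u ord0 i = 1 -> 0 <= u ord0 i <= 1.
  by move=> u0 u1; rewrite u0 -u1 (bigD1 i) //= lerDl sumr_ge0.
rewrite -es in tS' *; set s := [set i | _]%SET in es tS tS' *.
case E : (enum s) => [|i0 e] /ffunP lab.
  by have := Sn _ tS; rewrite cardE E.
have ds : (size e <= complex_dim S)%N.
  by rewrite /complex_dim (bigD1 _ tS) /= cardE E /= leq_maxl.
have close i : i != i0 -> `|t ord0 i - t' ord0 i| <= q%:R^-1.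
  move=> ii0; have [ini|nin] := boolP (i \in s); last first.
    have e1 : t ord0 i = 0 by move: nin; rewrite inE negbK => /eqP.
    have e2 : t' ord0 i = 0 by move: nin; rewrite es inE negbK => /eqP.
    by rewrite e1 e2 subrr normr0 invr_ge0.
  move: ini.
  rewrite -mem_enum E inE (negbTE ii0) /= => /(nthP i0)[r re <-].
  have rD := leq_trans re ds.
  have := lab (Ordinal rD); rewrite !ffunE /=; apply: grid_close => //; exact: itv.
have rest : \sum_(i | i != i0) `|t ord0 i - t' ord0 i| <= m%:R / q%:R.
  apply: (@le_trans _ _ (\sum_(i < m | i != i0) q%:R^-1)); first exact: ler_sum.
  apply: (@le_trans _ _ (\sum_(i < m) q%:R^-1)).
    by rewrite [leRHS](bigD1 i0) //= lerDr invr_ge0.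
  by rewrite sumr_const card_ord mulr_natl.
have last_coord : `|t ord0 i0 - t' ord0 i0| <= \sum_(i | i != i0) `|t ord0 i - t' ord0 i|.
  have -> : t ord0 i0 - t' ord0 i0 = \sum_(i | i != i0) (t' ord0 i - t ord0 i).
    move: t1 t1'; rewrite (bigD1 i0) //= => t1; rewrite (bigD1 i0) //= => t1'.
    by rewrite sumrB; lra.
  by apply: le_trans (ler_norm_sum _ _ _) _; apply: ler_sum => i _; rewrite distrC.
rewrite /l1 (bigD1 i0) //= natrM -mulrA [_%:R * _]mulrC mulr_natr mulr2n.
by rewrite lerD // (le_trans last_coord).
Qed.

End grids.

Section convexity.
Variables (R : realType) (V : normedModType R) (I : finType).
Implicit Types (c : I -> R) (v : I -> V).

Lemma convex_combination (K : set V) c v : convex_subset K ->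
  (forall i, 0 <= c i) -> \sum_i c i = 1 -> (forall i, K (v i)) -> K (\sum_i c i *: v i).
Proof.
move=> cK c0 c1 Kv.
(* Partial sums are normalised by their mass; a partial sum of mass 0 has no normalisation, hence
   the alternative. *)
have main (r : seq I) : \sum_(i <- r) c i = 0 \/
    (0 < \sum_(i <- r) c i /\ K ((\sum_(i <- r) c i)^-1 *: \sum_(i <- r) c i *: v i)).
  elim: r => [|i r IH]; first by left; rewrite big_nil.
  rewrite !big_cons; set s := \sum_(j <- r) c j in IH *.
  have s0 : 0 <= s by apply: sumr_ge0.
  have [ci0|ci0] := eqVneq (c i) 0; first by rewrite ci0 scale0r !add0r.
  have ci1 : 0 < c i by rewrite lt_def ci0 c0.
  right; split; first by rewrite ltr_wpDr.
  have n0 : c i + s != 0 by rewrite gt_eqF // ltr_wpDr.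
  case: IH => [sz|[sp Ks]].
    have z j : j \in r -> c j = 0.
      by move=> jr; move/eqP: sz; rewrite /s psumr_eq0 // => /allP/(_ j jr)/eqP.
    rewrite sz addr0 big1_seq ?addr0; first by rewrite scalerA mulVf // scale1r.
    by move=> j /andP[_ /z ->]; rewrite scale0r.
  have -> : (c i + s)^-1 *: (c i *: v i + \sum_(j <- r) c j *: v j) =
     (c i / (c i + s)) *: v i + (1 - c i / (c i + s)) *: (s^-1 *: \sum_(j <- r) c j *: v j).
    rewrite scalerDr !scalerA [_^-1 * c i]mulrC; congr (_ + _ *: _).
    by field; rewrite n0 gt_eqF.
  apply: cK => //; rewrite divr_ge0 ?addr_ge0 //=.
  by rewrite ler_pdivrMr ?ltr_wpDr // mul1r lerDl.
have [|[_]] := main (index_enum I); first by rewrite c1 => /eqP; rewrite oner_eq0.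
by rewrite c1 invr1 scale1r.
Qed.

Lemma convex_combination_close c v w e :
  (forall i, 0 <= c i) -> \sum_i c i = 1 -> (forall i, c i != 0 -> `|v i - w| <= e) ->
  `|\sum_i c i *: v i - w| <= e.
Proof.
move=> c0 c1 h; rewrite -[w]scale1r -c1 scaler_suml -sumrB.
apply: le_trans (ler_norm_sum _ _ _) _.
rewrite -[leRHS]mul1r -c1 mulr_suml; apply: ler_sum => i _.
rewrite -scalerBr normrZ ger0_norm //.
by have [->|ci] := eqVneq (c i) 0; [rewrite !mul0r|rewrite ler_wpM2l // h].
Qed.

Lemma combination_diff c c' v B : (forall i, `|v i| <= B) ->
  `|\sum_i c i *: v i - \sum_i c' i *: v i| <= B * \sum_i `|c i - c' i|.
Proof.
move=> hB; rewrite -sumrB; apply: le_trans (ler_norm_sum _ _ _) _.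
rewrite mulr_sumr; apply: ler_sum => i _.
by rewrite -scalerBl normrZ mulrC ler_wpM2r.
Qed.

End convexity.

Section lipschitz_partition.
Variables (R : realType) (X : topologicalType) (m : nat) (pi : X -> 'rV[R]_m).
Hypothesis cX : compact [set: X].
Hypothesis cpi : continuous pi.

(** Variation is measured by [l1] on the images, so the functions factor through [pi]
    quantitatively: points with nearby images have nearby coefficients. *)
Lemma lipschitz_partition (r : R) : 0 < r ->
  exists n (xs : 'I_n -> X) (psi : 'I_n -> X -> R) (C : R),
  [/\ forall i, continuous (psi i), forall i x, 0 <= psi i x,
      forall x, \sum_i psi i x = 1,
      forall i x, psi i x != 0 -> l1 (pi x) (pi (xs i)) < r &
      0 <= C /\ forall i x y, `|psi i x - psi i y| <= C * l1 (pi x) (pi y)].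
Proof.
move=> r0.
have cl a : continuous (fun x => l1 (pi a) (pi x)).
  by apply: continuous_l1 => // x; exact: cvg_cst.
have dd a : l1 (pi a) (pi a) = 0 by apply: big1 => i _; rewrite subrr normr0.
have [s hs] := finite_net cX cl dd (divr_gt0 r0 (ltr0n _ 2)).
pose n := size s; pose xs (i : 'I_n) := tnth (in_tuple s) i.
pose w i x := Num.max 0 (r - l1 (pi (xs i)) (pi x)).
pose W x := \sum_i w i x.
have w0 i x : 0 <= w i x by rewrite le_max lexx.
have W0 x : r / 2 <= W x.
  have [a /(nthP a)[i im <-] ar] := hs x.
  rewrite /W (bigD1 (Ordinal im)) //= -[leLHS]addr0 lerD //; last by apply: sumr_ge0.
  rewrite le_max; apply/orP; right; rewrite /xs (tnth_nth a) /=.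
  by move: ar; lra.
have Wp x : 0 < W x by apply: lt_le_trans (W0 x); rewrite divr_gt0.
have wW i x : w i x <= W x by rewrite /W (bigD1 i) //= lerDl sumr_ge0.
have cw i : continuous (w i).
  apply: continuous_maxr; first by move=> x; exact: cvg_cst.
  by apply: continuous_subr => [x|]; [exact: cvg_cst|exact: cl].
have lw i x y : `|w i x - w i y| <= l1 (pi x) (pi y).
  have h1 := l1_triangle (pi (xs i)) (pi x) (pi y).
  have h2 := l1_triangle (pi (xs i)) (pi y) (pi x).
  rewrite (l1C (pi y)) in h2; have h0 := l1_ge0 (pi x) (pi y).
  rewrite /w ler_norml; move: h0 h1 h2.
  move: (l1 (pi (xs i)) (pi x)) (l1 (pi (xs i)) (pi y)) (l1 (pi x) (pi y)) => p q l *.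
  by case: (leP 0 (r - p)) => ?; case: (leP 0 (r - q)) => ?; apply/andP; split; lra.
have lW x y : `|W x - W y| <= n%:R * l1 (pi x) (pi y).
  rewrite /W -sumrB; apply: le_trans (ler_norm_sum _ _ _) _.
  apply: (@le_trans _ _ (\sum_(i < n) l1 (pi x) (pi y))); first exact: ler_sum.
  by rewrite sumr_const card_ord mulr_natl.
exists n, xs, (fun i x => w i x / W x), ((n.+1)%:R * (2 / r)); split.
- move=> i x; apply: cvgM; first exact: cw.
  apply: cvgV; first by rewrite gt_eqF.
  by apply: continuous_sumr => j _; exact: cw.
- by move=> i x; rewrite divr_ge0 // ltW.
- by move=> x; rewrite -mulr_suml -/(W x) divff // gt_eqF.
- move=> i x h; rewrite l1C ltNge; apply/negP => le; move/negP: h; apply.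
  by rewrite /w (max_idPl _) ?mul0r // subr_le0.
- split; first by rewrite mulr_ge0 // divr_ge0 // ltW.
  move=> i x y.
  (* As [w i y / W y <= 1], the quotient varies at most as much as [w i] and [W] together, divided
     by [W x >= r / 2]; this is the origin of the constant [n.+1 * (2 / r)]. *)
  have -> : w i x / W x - w i y / W y =
     ((w i x - w i y) + (w i y / W y) * (W y - W x)) / W x.
    by field; rewrite !gt_eqF.
  rewrite normrM normfV (gtr0_norm (Wp x)) ler_pdivrMr //.
  apply: (@le_trans _ _ (n.+1%:R * l1 (pi x) (pi y))).
    apply: le_trans (ler_normD _ _) _; rewrite -natr1 mulrDl mul1r addrC lerD //.
    rewrite normrM -[leRHS]mul1r ler_pM //; last by rewrite distrC.
    rewrite ger0_norm ?divr_ge0 ?(ltW (Wp y)) //.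
    by rewrite ler_pdivrMr // mul1r.
  rewrite -mulrA -mulrA ler_wpM2l //.
  have -> : 2 / r * (l1 (pi x) (pi y) * W x) = l1 (pi x) (pi y) * (W x * (2 / r)) by ring.
  by rewrite ler_peMr ?l1_ge0 // mulrA ler_pdivlMr // mul1r -ler_pdivrMr.
Qed.

End lipschitz_partition.

(** * Counting labels on a window *)

Section window.
Variables (R : realType) (V : normedModType R).
Variables (k : nat) (X : metricType R) (T : 'rV[int]_k -> X -> X).
Variables (L : nat) (lam : {ffun 'I_k -> 'I_L} -> X -> R).
Hypothesis lam_ge0 : forall p x, 0 <= lam p x.
Hypothesis lam_sum : forall x, \sum_p lam p x = 1.

Lemma lam_clean p p' x : lam p x = 1 -> p' != p -> lam p' x = 0.
Proof.
move=> lp pp; apply/eqP; rewrite eq_le lam_ge0 andbT.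
have := lam_sum x; rewrite (bigD1 p) //= (bigD1 p') //= lp => e.
have : 0 <= \sum_(i | (i != p) && (i != p')) lam i x by apply: sumr_ge0.
by lra.
Qed.

(** Clean boxes are disjoint: at a common site two weights of different position would both be 1,
    while equal positions force equal starts. *)
Lemma clean_starts_card M x : (#|clean_starts T lam M x| * L ^ k <= M ^ k)%N.
Proof.
pose D := ({j | j \in clean_starts T lam M x} * {ffun 'I_k -> 'I_L})%type.
have lt (d : D) i : (val d.1 i + d.2 i < M)%N.
  case: d => -[j jc] p /=; move: jc; rewrite inE => /asboolP[h _].
  by have := h i; have := ltn_ord (p i); lia.
pose h (d : D) : {ffun 'I_k -> 'I_M} := [ffun i => Ordinal (lt d i)].
have hE d : zpt (h d) = zpt (val d.1) + zpt d.2.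
  by apply/rowP => i; rewrite !mxE ffunE /= PoszD.
have hinj : injective h.
  move=> [[j jc] p] [[j' jc'] p'] e.
  have {}e : zpt j + zpt p = zpt j' + zpt p'.
    by have := hE (exist _ j jc, p); rewrite e hE /= => ->.
  have pp : p = p'.
    apply/eqP/negPn/negP => ne.
    have := jc; rewrite inE => /asboolP[_ /(_ p) c1].
    have := jc'; rewrite inE => /asboolP[_ /(_ p') c2].
    rewrite -e in c2; have := lam_clean c2 ne; rewrite c1 => /eqP.
    by rewrite oner_eq0.
  rewrite pp in e *; congr (_, _); apply/val_inj => /=.
  by move: e => /addIr /zpt_inj.
have := leq_card h hinj.
by rewrite card_prod card_sig !card_box.
Qed.

Variables (g : X -> V) (I1 I0 : finType) (lab1 : X -> I1) (lab0 : X -> I0) (c : R).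
Hypothesis lab1P : forall x y (j : 'rV[int]_k),
  (forall p, lam p (T (j + zpt p) x) = 1) -> (forall p, lam p (T (j + zpt p) y) = 1) ->
  lab1 (T j x) = lab1 (T j y) ->
  forall p : {ffun 'I_k -> 'I_L}, `|g (T (j + zpt p) x) - g (T (j + zpt p) y)| <= c.
Hypothesis lab0P : forall x y, lab0 x = lab0 y -> `|g x - g y| <= c.

(* A label records which boxes are clean, one label of I1 per clean box and one label of
   I0 per remaining site. *)
Lemma window_labels M n1 n0 :
  (forall x, #|clean_starts T lam M x| <= n1)%N ->
  (forall x, #|~: clean_sites T lam M x| <= n0)%N ->
  exists (I : finType) (l : X -> I),
    #|I| = (2 ^ (M ^ k) * #|I1| ^ n1 * #|I0| ^ n0)%N /\
    forall x y, l x = l y -> forall a : {ffun 'I_k -> 'I_M},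
      `|g (T (zpt a) x) - g (T (zpt a) y)| <= c.
Proof.
move=> h1 h0.
pose sites (A : {set {ffun 'I_k -> 'I_M}}) := [seq zpt j | j <- enum A].
have sitesP (A : {set {ffun 'I_k -> 'I_M}}) j : j \in A -> exists2 r, (r < #|A|)%N & nth 0 (sites A) r = zpt j.
  rewrite -mem_enum => jA; have : zpt j \in sites A by apply/mapP; exists j.
  by move=> /(nthP 0)[r rs e]; exists r => //; rewrite cardE; rewrite size_map in rs.
(* Entry [r] is read at the [r]-th site of a list determined by the first component, so equal labels
   compare [x] and [y] at the same sites; past the end of the list the site is 0. *)
pose l x := (clean_starts T lam M x,
  ([ffun r : 'I_n1 => lab1 (T (nth 0 (sites (clean_starts T lam M x)) r) x)],
   [ffun r : 'I_n0 => lab0 (T (nth 0 (sites (~: clean_sites T lam M x)) r) x)])).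
exists ({set {ffun 'I_k -> 'I_M}} * ({ffun 'I_n1 -> I1} * {ffun 'I_n0 -> I0}))%type, l.
split.
  by rewrite !card_prod !card_ffun !card_ord -cardsT -powersetT card_powerset cardsT card_box mulnA.
move=> x y [ecs /ffunP e1 /ffunP e0] a.
have ecl : clean_sites T lam M y = clean_sites T lam M x by rewrite /clean_sites ecs.
have [ac|anc] := boolP (a \in clean_sites T lam M x).
  move: ac; rewrite inE => /exists_inP[j jx /existsP[p /eqP ->]].
  have jy : j \in clean_starts T lam M y by rewrite -ecs.
  have [r rlt er] := sitesP _ _ jx.
  apply: lab1P; [by move: jx; rewrite inE => /asboolP[]|by move: jy; rewrite inE => /asboolP[]|].
  by have := e1 (Ordinal (leq_trans rlt (h1 x))); rewrite !ffunE /= -ecs er.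
have anc' : a \in ~: clean_sites T lam M x by rewrite inE.
have [r rlt er] := sitesP _ _ anc'.
apply: lab0P.
by have := e0 (Ordinal (leq_trans rlt (h0 x))); rewrite !ffunE /= ecl er.
Qed.

End window.

Section density.
Variables (R : realType) (V : normedModType R) (K : set V).
Variables (k : nat) (X : metricType R) (T : 'rV[int]_k -> X -> X).
Hypothesis cX : compact [set: X].
Hypothesis aT : is_Zk_action T.
Variable B : R.
Hypothesis B0 : 0 <= B.
Hypothesis KB : forall v, K v -> `|v| <= B.

Lemma diam_le u v : K u -> K v -> `|u - v| <= B + B.
Proof.
by move=> /KB hu /KB hv; apply: le_trans (ler_normB _ _) _; exact: lerD.
Qed.

Lemma uniform_modulus (f : X -> V) (e : R) : continuous f -> 0 < e ->
  exists2 eta, 0 < eta & forall x y, mdist x y < eta -> `|f x - f y| < e.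
Proof.
move=> cf e0.
have cu : continuous (fun z : X * X => `|f z.1 - f z.2|).
  move=> z; apply: cvg_norm; apply: cvgB.
    by apply: (@continuous_comp _ _ _ fst f); [exact: cvg_fst|exact: cf].
  by apply: (@continuous_comp _ _ _ snd f); [exact: cvg_snd|exact: cf].
have [|eta eta0 h] := compact_pos_lower (compact_setXT cX) cu (@continuous_mdist R X) (e := e).
  move=> [x y] /= le; rewrite mdist_gt0; apply: contraTneq le => ->.
  by rewrite subrr normr0 -ltNge.
exists eta => // x y lt; rewrite ltNge; apply/negP => le.
by have := h (x, y) le; rewrite leNgt lt.
Qed.

(** Fibers concern points with equal images; compactness extends the bound to points with nearby
    images. *)
Lemma small_fibers_modulus m (pi : X -> 'rV[R]_m) eta N :
  continuous pi -> small_fibers T eta pi (zbox k N) ->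
  exists2 r, 0 < r & forall x y, l1 (pi x) (pi y) < r ->
    forall n, zbox k N n -> mdist (T n x) (T n y) < eta.
Proof.
move=> cpi sf; have [_ [_ cT]] := aT.
have cv : continuous (fun z : X * X => l1 (pi z.1) (pi z.2)).
  apply: (@continuous_l1 R (X * X)%type m (pi \o fst) (pi \o snd)) => z;
    apply: continuous_comp => //; [exact: cvg_fst|exact: cpi|exact: cvg_snd|exact: cpi].
have : forall j : {ffun 'I_k -> 'I_N}, exists r, 0 < r /\ forall z : X * X,
    eta <= mdist (T (zpt j) z.1) (T (zpt j) z.2) -> r <= l1 (pi z.1) (pi z.2).
  move=> j.
  have cu : continuous (fun z : X * X => mdist (T (zpt j) z.1) (T (zpt j) z.2) : R).
    move=> z; apply: (@continuous_comp _ _ _ (fun z : X * X => (T (zpt j) z.1, T (zpt j) z.2))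
      (fun z => mdist z.1 z.2)); last exact: continuous_mdist.
    apply: cvg_pair.
      by apply: (@continuous_comp _ _ _ fst (T (zpt j))); [exact: cvg_fst|exact: cT].
    by apply: (@continuous_comp _ _ _ snd (T (zpt j))); [exact: cvg_snd|exact: cT].
  have [|r r0 h] := compact_pos_lower (compact_setXT cX) cu cv (e := eta); last by exists r.
  move=> [x y] /= le; rewrite lt_neqAle l1_ge0 andbT eq_sym; apply/negP => /eqP /l1_eq0 e.
  have [c /andP[_ ce] hc] := sf (pi y).
  have := hc x y e erefl _ (zbox_zpt j).
  by rewrite leNgt (lt_le_trans ce).
move=> /choice[r hr].
have pos j : 0 < (r j)^-1 by rewrite invr_gt0; have [] := hr j.
have sum0 : 0 <= \sum_j (r j)^-1 by apply: sumr_ge0 => j _; exact: ltW.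
(* A positive number below every [r j], written without a minimum. *)
exists (1 + \sum_j (r j)^-1)^-1; first by rewrite invr_gt0 ltr_wpDr.
move=> x y lt _ /zboxP[j ->]; rewrite ltNge; apply/negP => le.
have [rj0 h] := hr j; have := h (x, y) le; rewrite leNgt => /negP; apply.
apply: (lt_le_trans lt); rewrite invf_ple ?posrE ?ltr_wpDr //.
rewrite (bigD1 j) //= addrCA lerDl addr_ge0 //.
by apply: sumr_ge0 => i _; exact: ltW.
Qed.

(** A window with margin [b] on every side, read after a shift by [-b], controls the coordinates
    that matter for [Dshift]; the tail costs the diameter [B + B] times [t]. *)
Lemma labels_window (g : X -> V) M N b (c t : R) p : CXK K g -> 0 <= c ->
  (\esum_(n in ~` [set n : 'rV[int]_k | forall i, (`|n ord0 i| <= b%:Z)%R]) (zweight R n)%:E <= t%:E)%E ->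
  M = (N + 2 * b)%N ->
  (exists (I : finType) (l : X -> I), #|I| = p /\
    forall x y, l x = l y -> forall a : {ffun 'I_k -> 'I_M},
      `|g (T (zpt a) x) - g (T (zpt a) y)| <= c) ->
  labels T g (c * zmass R k + (B + B) * t) N p.
Proof.
move=> [cg Kg] c0 ht MN [I [l [Ip hl]]]; have [_ [TD _]] := aT.
exists I, (fun x => l (T (- const_mx b%:Z) x)); split; first by rewrite Ip.
move=> x y lxy m bm; apply: (Dshift_window (b := b)) => //; first by rewrite addr_ge0.
  move=> n hn; rewrite /Imap -!TD.
  have h i : (`|((n + m) ord0 i + b%:Z)%R| < M)%N.
    have := hn i; have [] := bm i; rewrite mxE MN.
    by move: (n ord0 i) (m ord0 i) => u w; lia.
  pose a : {ffun 'I_k -> 'I_M} := [ffun i => Ordinal (h i)].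
  have e : n + m = zpt a + (- const_mx b%:Z).
    apply/rowP => i; rewrite [RHS]mxE [zpt a _ _]mxE ffunE /= gez0_abs; first by rewrite !mxE addrK.
    have := hn i; have [] := bm i; rewrite mxE.
    by move: (n ord0 i) (m ord0 i) => u w; lia.
  by rewrite e !TD; exact: hl.
by move=> n; apply: diam_le; exact: Kg.
Qed.

(** Only the coefficient of [ln q.+1] survives at small scales: the dimension per site of a box,
    plus [D'] for the proportion [th] of other sites. The [ln 2] terms do not depend on [q]. *)
Lemma ln_count (Mk iL m D D' q n1 n0 : nat) (th : R) :
  (0 < iL)%N -> (n1 * iL <= Mk)%N -> n0%:R <= th * Mk%:R ->
  ln ((2 ^ Mk * (2 ^ m * q.+1 ^ D) ^ n1 * (q.+1 ^ D') ^ n0)%N%:R : R) <=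
  Mk%:R * ((1 + m%:R) * ln 2 + (D%:R / iL%:R + th * D'%:R) * ln q.+1%:R).
Proof.
move=> iL0 hn1 hn0.
rewrite !natrM !lnM ?posrE ?ltr0n ?expn_gt0 ?muln_gt0 ?expn_gt0 ?orbT //.
rewrite !ln_natX natrM lnM ?posrE ?ltr0n ?expn_gt0 // !ln_natX.
have l2 : 0 <= ln (2 : R) by apply: ln_ge0; rewrite ler1n.
have lq : 0 <= ln (q.+1%:R : R) by apply: ln_ge0; rewrite ler1n.
have i0 : (0 : R) < iL%:R by rewrite ltr0n.
have h1 : n1%:R <= Mk%:R / iL%:R :> R by rewrite ler_pdivlMr // -natrM ler_nat.
have h1' : n1%:R <= Mk%:R :> R.
  by rewrite ler_nat (leq_trans _ hn1) // leq_pmulr.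
have e1 : n1%:R * (m%:R * ln 2) <= Mk%:R * (m%:R * ln 2 : R) by rewrite ler_wpM2r ?mulr_ge0.
have e2 : n1%:R * (D%:R * ln q.+1%:R) <= Mk%:R / iL%:R * (D%:R * ln q.+1%:R) :> R.
  by rewrite ler_wpM2r ?mulr_ge0.
have e3 : n0%:R * (D'%:R * ln q.+1%:R) <= th * Mk%:R * (D'%:R * ln q.+1%:R) :> R.
  by rewrite ler_wpM2r ?mulr_ge0.
have -> : Mk%:R * ((1 + m%:R) * ln 2 + (D%:R / iL%:R + th * D'%:R) * ln q.+1%:R) =
  Mk%:R * ln 2 + (Mk%:R * (m%:R * ln 2) + Mk%:R / iL%:R * (D%:R * ln q.+1%:R)) +
  th * Mk%:R * (D'%:R * ln q.+1%:R) :> R by ring.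
by rewrite mulrDr !lerD.
Qed.

End density.

(** * Approximation by functions of low entropy *)

Section density_main.
Variables (R : realType) (V : normedModType R) (K : set V).
Variables (k : nat) (X : metricType R) (T : 'rV[int]_k -> X -> X).
Hypothesis cX : compact [set: X].
Hypothesis aT : is_Zk_action T.
Hypothesis mT : marker_property T.
Hypothesis convK : convex_subset K.
Variable B : R.
Hypothesis B0 : 0 <= B.
Hypothesis KB : forall v, K v -> `|v| <= B.

Section construction.
Variables (L n m : nat) (S : {set {set 'I_m}}) (pi : X -> 'rV[R]_m).
Hypothesis pS : polymap S pi.
Variables (psi : 'I_n -> X -> R) (C : R).
Hypothesis psi_cont : forall i, continuous (psi i).
Hypothesis psi_ge0 : forall i x, 0 <= psi i x.
Hypothesis psi_sum : forall x, \sum_i psi i x = 1.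
Hypothesis C0 : 0 <= C.
Hypothesis psi_lip : forall i x y, `|psi i x - psi i y| <= C * l1 (pi x) (pi y).
Variable lam : {ffun 'I_k -> 'I_L} -> X -> R.
Hypothesis lam_cont : forall p, continuous (lam p).
Hypothesis lam_ge0 : forall p x, 0 <= lam p x.
Hypothesis lam_sum : forall x, \sum_p lam p x = 1.

Let J := ({ffun 'I_k -> 'I_L} * 'I_n)%type.
Variable v : J -> V.
Hypothesis Kv : forall i, K (v i).

Let coef (i : J) x : R := lam i.1 x * psi i.2 (T (- zpt i.1) x).

Definition glued (x : X) : V := \sum_i coef i x *: v i.

Lemma coef_ge0 i x : 0 <= coef i x.
Proof. by rewrite mulr_ge0. Qed.

Lemma coef_sum x : \sum_i coef i x = 1.
Proof.
rewrite -(pair_bigA _ (fun p a => lam p x * psi a (T (- zpt p) x))) /=.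
under eq_bigr do rewrite -mulr_sumr psi_sum mulr1.
exact: lam_sum.
Qed.

Lemma coef_itv i x : 0 <= coef i x <= 1.
Proof.
rewrite coef_ge0 -(coef_sum x) (bigD1 i) //= lerDl sumr_ge0 // => j _; exact: coef_ge0.
Qed.

Lemma glued_CXK : CXK K glued.
Proof.
have [_ [_ cT]] := aT.
split; last by move=> x; apply: convex_combination => //; [move=> i; exact: coef_ge0|exact: coef_sum].
apply: continuous_big => [|i _ x]; first exact: add_continuous.
apply: cvgZr_tmp; apply: cvgM; first exact: lam_cont.
by apply: (@continuous_comp _ _ _ (T (- zpt i.1)) (psi i.2)); [exact: cT|exact: psi_cont].
Qed.

(** At position [p] of a clean box only the coefficients with first index [p] survive, and they are
    values of [psi] at [T j x], the same base point for all [p]. One label of that point therefore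
    serves the whole box. *)
Lemma glued_clean q x y (j : 'rV[int]_k) : (0 < q)%N ->
  (forall p, lam p (T (j + zpt p) x) = 1) -> (forall p, lam p (T (j + zpt p) y) = 1) ->
  realization_label (complex_dim S) q (pi (T j x)) =
  realization_label (complex_dim S) q (pi (T j y)) ->
  forall p : {ffun 'I_k -> 'I_L},
    `|glued (T (j + zpt p) x) - glued (T (j + zpt p) y)| <=
    B * (n%:R * (C * (2 * m)%N%:R)) / q%:R.
Proof.
move=> q0 cx cy lab p; have [_ [TD _]] := aT; have [hS _ hr] := pS.
have coefE z : (forall p, lam p (T (j + zpt p) z) = 1) ->
    forall i, coef i (T (j + zpt p) z) = if i.1 == p then psi i.2 (T j z) else 0.
  move=> cz [p' a]; rewrite /coef /=; case: eqVneq => [->|ne].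
    by rewrite cz mul1r -TD addrC addrK.
  by rewrite (lam_clean lam_ge0 lam_sum (cz p) ne) mul0r.
apply: le_trans (combination_diff _ _ (fun i => KB (Kv i))) _.
rewrite -mulrA; apply: ler_wpM2l => //.
under eq_bigr do rewrite (coefE x cx) (coefE y cy).
rewrite -(pair_bigA _ (fun p' a => `|(if p' == p then psi a (T j x) else 0) -
   (if p' == p then psi a (T j y) else 0)|)) /=.
rewrite (bigD1 p) //= [X in _ + X]big1 ?addr0; last first.
  by move=> p' /negbTE ->; apply: big1 => a _; rewrite subrr normr0.
rewrite eqxx.
apply: (@le_trans _ _ (\sum_(a < n) C * ((2 * m)%N%:R / q%:R))).
  apply: ler_sum => a _; apply: le_trans (psi_lip _ _ _) _; apply: ler_wpM2l => //.
  exact: realization_label_close lab.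
by rewrite sumr_const card_ord -[leLHS]mulr_natl !mulrA.
Qed.

Lemma glued_grid q x y : (0 < q)%N ->
  [ffun i => grid q (coef i x)] = [ffun i => grid q (coef i y)] ->
  `|glued x - glued y| <= B * #|{: J}|%:R / q%:R.
Proof.
move=> q0 /ffunP e.
apply: le_trans (combination_diff _ _ (fun i => KB (Kv i))) _.
rewrite -mulrA; apply: ler_wpM2l => //.
apply: (@le_trans _ _ (\sum_(i : J) q%:R^-1)); last by rewrite sumr_const mulr_natl.
apply: ler_sum => i _; apply: grid_close; rewrite ?coef_itv //.
by have := e i; rewrite !ffunE.
Qed.

Let Cg := B * (n%:R * (C * (2 * m)%N%:R)) + B * #|{: J}|%:R.

Lemma glued_window q M n1 n0 : (0 < q)%N ->
  (forall x, #|clean_starts T lam M x| <= n1)%N ->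
  (forall x, #|~: clean_sites T lam M x| <= n0)%N ->
  exists (I : finType) (l : X -> I),
    #|I| = (2 ^ (M ^ k) * (2 ^ m * q.+1 ^ complex_dim S) ^ n1 * (q.+1 ^ #|{: J}|) ^ n0)%N /\
    forall x y, l x = l y -> forall a : {ffun 'I_k -> 'I_M},
      `|glued (T (zpt a) x) - glued (T (zpt a) y)| <= Cg / q%:R.
Proof.
move=> q0 h1 h0.
have i0 : 0 <= q%:R^-1 :> R by rewrite invr_ge0.
have [||I [l [cI hl]]] := @window_labels R V k X T L lam glued _ _
  (fun x => realization_label (complex_dim S) q (pi x))
  (fun x => [ffun i => grid q (coef i x)]) (Cg / q%:R) _ _ M n1 n0 h1 h0.
- move=> x y j cx cy lab p; apply: le_trans (glued_clean q0 cx cy lab p) _.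
  by rewrite ler_wpM2r // /Cg lerDl mulr_ge0.
- move=> x y lab; apply: le_trans (glued_grid q0 lab) _.
  by rewrite ler_wpM2r // /Cg lerDr !mulr_ge0.
exists I, l; split => //.
rewrite cI !card_prod !card_ffun !card_ord -cardsT -powersetT card_powerset cardsT card_ord.
by rewrite card_prod card_ffun !card_ord.
Qed.

End construction.

Lemma low_entropy_dense (f : X -> V) (e del a : R) : (mean_dim T < a%:E)%E -> CXK K f ->
  0 < e -> 0 < del -> exists g, [/\ CXK K g, low_entropy T g del a & sup_dist f g < e].
Proof.
move=> ma [cf Kf] e0 del0; have [T0 [TD cT]] := aT.
(* The gap [gam = a - a0] is spent in quarters: on the sites outside clean boxes, on the terms
   independent of the scale, on enlarging the window, and on strictness. *)
have [a0 [ma0 a00 a0a]] : exists a0, [/\ (mean_dim T < a0%:E)%E, 0 < a0 & a0 < a].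
  have := mean_dim_ge0 cX aT; case: (mean_dim T) ma => [m| |] //= ma m0.
  rewrite lte_fin in ma; rewrite lee_fin in m0.
  by exists ((m + a) / 2); rewrite lte_fin; split; lra.
have e20 : 0 < e / 2 by rewrite divr_gt0.
have [eta eta0 heta] := uniform_modulus cX cf e20.
have [L [D [L0 [m [S [pi [pS sf dS]]]] Da]]] := mean_dim_lt cX aT ma0 eta0.
have cpi : continuous pi by case: pS.
have [r r0 hr] := small_fibers_modulus cX aT cpi sf.
have [n [xs [psi [C [cpsi psi0 psi1 psir [C0 psiL]]]]]] := lipschitz_partition cX cpi r0.
pose J := ({ffun 'I_k -> 'I_L} * 'I_n)%type; pose D' := #|{: J}|.
pose gam := a - a0; have gam0 : 0 < gam by rewrite subr_gt0.
pose th := gam / (4 * (D'%:R + 1)).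
have D'1 : 0 < D'%:R + 1 :> R by rewrite ltr_wpDl.
have th0 : 0 < th by rewrite divr_gt0 // mulr_gt0.
have thD : th * D'%:R <= gam / 4.
  have -> : th * D'%:R = gam / 4 * (D'%:R / (D'%:R + 1)) by rewrite /th; field; rewrite gt_eqF.
  by rewrite ler_piMr ?divr_ge0 ?(ltW gam0) // ler_pdivrMr // mul1r lerDl.
have [lam [clam lam0 lam1 [M0 _ hM0]]] := soft_tower cX aT mT L0 th0.
pose v (i : J) := f (T (zpt i.1) (xs i.2)).
have Kv i : K (v i) by exact: Kf.
pose g := glued psi lam v.
have cg : CXK K g by exact: glued_CXK.
have fg : sup_dist f g < e.
  apply: (@le_lt_trans _ _ (e / 2)); last by rewrite ltr_pdivrMr // ltr_pMr // ltr1n.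
  apply: sup_dist_le; [exact: ltW|move=> x; rewrite distrC].
  (* A nonzero coefficient puts the image of [T (- p) x] within [r] of that of a net point; then
     [T p] brings the net point within [eta] of [x], and the vertex is close to [f x]. *)
  apply: convex_combination_close; [move=> i; exact: coef_ge0|exact: coef_sum|move=> [p al]].
  rewrite mulf_eq0 negb_or /v /= => /andP[_ /psir /hr/(_ _ (zbox_zpt p)) near].
  rewrite distrC; apply/ltW/heta; move: near.
  by rewrite -TD subrr T0.
exists g; split => //.
pose Z := zmass R k; have Z0 : 0 <= Z by exact: zmass_ge0.
pose Cg := B * (n%:R * (C * (2 * m)%N%:R)) + B * D'%:R.
have Cg0 : 0 <= Cg by rewrite addr_ge0 ?mulr_ge0.
(* With scale [1/Q] and grid size [q = h * Q], a fixed [h] makes the grid contribution to [Dshift]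
   at most a quarter of the scale. *)
have [h h0 hC] : exists2 h : nat, (0 < h)%N & 4 * (Cg * Z) <= h%:R.
  exists (Num.truncn (4 * (Cg * Z))).+1 => //.
  have := truncn_itv (_ : 0 <= 4 * (Cg * Z)); rewrite !mulr_ge0 // => /(_ isT)/andP[_ /ltW].
  by [].
pose s := a0 + gam / 4; have s0 : 0 < s by rewrite addr_gt0 ?divr_gt0.
(* What remains of the count apart from the multiple of [ln Q], once [ln q.+1] is bounded by
   [ln (2 * h) + ln Q]. *)
pose H := (1 + m%:R) * ln 2 + s * ln (2 * h%:R) : R.
have [Q [Q2 Qdel QH]] : exists Q : nat, [/\ (2 <= Q)%N, (Q%:R)^-1 < del & H <= gam / 4 * ln (Q%:R : R)].
  near \oo => Q; exists Q.
  have Q2 : (2 <= Q)%N by near: Q; exact: nbhs_infty_gt.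
  have Qp : (0 : R) < Q%:R by rewrite ltr0n ltnW.
  split => //.
    rewrite invf_plt ?posrE //; near: Q; exact: nbhs_infty_gtr.
  rewrite mulrC -ler_pdivrMr ?divr_gt0 //.
  have QE : expR (H / (gam / 4)) < Q%:R by near: Q; exact: nbhs_infty_gtr.
  by rewrite -(expRK (H / (gam / 4))) ler_ln ?posrE ?expR_gt0 // ltW.
have Qp : (0 : R) < Q%:R by rewrite ltr0n ltnW.
have lnQ : 0 < ln (Q%:R : R) by rewrite ln_gt0 // ltr1n.
have [q q0 qE] : exists2 q : nat, (0 < q)%N & q%:R = h%:R * Q%:R :> R.
  by exists (h * Q)%N; [rewrite muln_gt0 h0 /= ltnW|rewrite natrM].
have hp : (0 : R) < h%:R by rewrite ltr0n.
pose d := B + B; have d0 : 0 <= d by rewrite addr_ge0.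
(* The tail contributes at most another quarter of the scale [1/Q], so [e'] stays below it. *)
pose t := (4 * (d + 1) * Q%:R)^-1.
have d1 : 0 < d + 1 by rewrite ltr_wpDl.
have t0 : 0 < t by rewrite invr_gt0 !mulr_gt0.
have [b hb] := zweight_tail k t0.
(* The labels for [N] are counted on the larger window [M]; [rho] bounds the ratio of volumes and
   raises [a0 + gam / 2] by exactly [gam / 4]. *)
pose rho := 1 + gam / (4 * (a0 + gam / 2)).
have s'0 : 0 < a0 + gam / 2 by rewrite addr_gt0 ?divr_gt0.
have rho1 : 1 < rho by rewrite ltrDl divr_gt0 // mulr_gt0.
have rhoE : rho * (a0 + gam / 2) = a0 + gam / 2 + gam / 4.
  by rewrite /rho; field; rewrite gt_eqF //; move: s'0; lra.
have [N1 _ hN1] := pow_ratio_le k (2 * b) rho1.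
have [N [N0 NN1 NM0]] : exists N, [/\ (0 < N)%N, (N1 <= N)%N & (M0 <= N)%N].
  by exists (N1 + M0).+1; split => //; rewrite ltnW // ltnS ?leq_addr ?leq_addl.
have MN := hN1 N NN1.
have [M ME] : exists M, M = (N + 2 * b)%N by exists (N + 2 * b)%N.
have hM := hM0 M (_ : (M0 <= M)%N).
have {}hM : forall x, #|~: clean_sites T lam M x|%:R <= th * ((M ^ k)%N)%:R.
  by apply: hM; rewrite ME (leq_trans NM0) ?leq_addr.
rewrite /= -ME in MN.
have Lk : (0 < L ^ k)%N by rewrite expn_gt0 L0.
pose n1 := ((M ^ k) %/ (L ^ k))%N; pose n0 := Num.truncn (th * ((M ^ k)%N)%:R).
have thM : 0 <= th * ((M ^ k)%N)%:R by rewrite mulr_ge0 // ltW.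
have hn1 x : (#|clean_starts T lam M x| <= n1)%N.
  by rewrite leq_divRL //; exact: clean_starts_card.
have hn0 x : (#|~: clean_sites T lam M x| <= n0)%N.
  by rewrite -ltnS -(ltr_nat R); apply: le_lt_trans (hM x) _; have /andP[] := truncn_itv thM.
have win := @glued_window L n m S pi pS psi C psi0 psi1 C0 psiL lam lam0 lam1 v Kv q M n1 n0 q0 hn1 hn0.
have c0 : 0 <= Cg / q%:R by rewrite divr_ge0.
have lab := labels_window aT B0 KB cg c0 hb ME win.
have lnp := @ln_count R (M ^ k)%N (L ^ k)%N m (complex_dim S) D' q n1 n0 th Lk
  (leq_trunc_div _ _) (proj1 (andP (truncn_itv thM))).
set e' := _ + _ in lab; set p := (_ * _ * _)%N in lab lnp.
exists (Q%:R^-1), e', N, p; split => //.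
- by rewrite invr_gt0 Qp.
- apply/andP; split.
    by rewrite /e' addr_ge0 // mulr_ge0 // ltW.
  have x1 : Cg / q%:R * Z <= Q%:R^-1 / 4.
    rewrite qE invfM mulrA mulrAC [Q%:R^-1 / 4]mulrC ler_wpM2r ?invr_ge0 ?(ltW Qp) //.
    by rewrite mulrAC ler_pdivrMr //; move: hC; lra.
  have x2 : d * t <= Q%:R^-1 / 4.
    have -> : d * t = Q%:R^-1 / 4 * (d / (d + 1)).
      by rewrite /t; field; rewrite !gt_eqF.
    by rewrite ler_piMr ?divr_ge0 ?invr_ge0 ?(ltW Qp) // ler_pdivrMr // mul1r lerDl.
  have : 0 < Q%:R^-1 :> R by rewrite invr_gt0.
  by rewrite /e'; move: x1 x2; rewrite -/Z -/d; lra.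
- have Mk0 : 0 <= ((M ^ k)%N)%:R :> R by [].
  have Nk0 : 0 < ((N ^ k)%N)%:R :> R by rewrite ltr0n expn_gt0 N0.
  rewrite lnV ?posrE // normrN gtr0_norm //.
  apply: (le_lt_trans lnp).
  have lnq : ln (q.+1%:R : R) <= ln (2 * h%:R) + ln (Q%:R).
    rewrite -lnM ?posrE ?mulr_gt0 // ler_ln ?posrE ?mulr_gt0 ?ltr0n ?(ltnW Q2) //.
    by rewrite -mulrA -qE -(natrM R 2 q) ler_nat mul2n -addnn -addn1 leq_add2l.
  have lnq0 : 0 <= ln (q.+1%:R : R) by apply: ln_ge0; rewrite ler1n.
  have sD : (complex_dim S)%:R / ((L ^ k)%N)%:R + th * D'%:R <= s.
    by rewrite /s lerD // ler_pdivrMr ?ltr0n // dS ltW.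
  have step : (1 + m%:R) * ln 2 +
     ((complex_dim S)%:R / ((L ^ k)%N)%:R + th * D'%:R) * ln q.+1%:R <=
     (a0 + gam / 2) * ln (Q%:R : R).
    have y1 := ler_wpM2r lnq0 sD; have y2 := ler_wpM2l (ltW s0) lnq.
    rewrite mulrDr in y2.
    move: y1 y2 QH; rewrite /H /s; lra.
  apply: le_lt_trans (ler_wpM2l Mk0 step) _.
  apply: le_lt_trans (ler_wpM2r _ MN) _; first by rewrite mulr_ge0 // ltW.
  rewrite mulrA ltr_pM2r // mulrAC rhoE mulrC [a * _]mulrC ltr_pM2l //.
  by rewrite /gam; move: gam0; rewrite /gam; lra.
Unshelve. all: by end_near. Qed.

End density_main.

Theorem theorem6p2 (R : realType) (V : completeNormedModType R) (K : set V)
  (k : nat) (X : metricType R) (T : 'rV[int]_k -> X -> X) :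
  compact K -> convex_subset K ->
  compact [set: X] -> is_Zk_action T -> marker_property T ->
  exists G : set (X -> V),
    dense_Gdelta_in K G /\
    forall f, G f ->
      (metric_mdim (@zshift k V) (range (Imap T f)) (@Dshift R k V)
       <= mean_dim T)%E.
Proof.
move=> cK convK cX aT mT.
have closedK : closed K by apply: compact_closed => //; exact: norm_hausdorff.
have [B B0 KB] : exists2 B : R, 0 <= B & forall v, K v -> `|v| <= B.
  have /ex_strict_bound_gt0[B B0 hB] := compact_bounded cK.
  by exists B; [exact: ltW|move=> v Kv; apply/ltW/hB].
have Kd := diam_le KB; have d0 : 0 <= B + B by rewrite addr_ge0.
have := mean_dim_ge0 cX aT; case mE : (mean_dim T) => [m| |] // m0; last first.
  (* Infinite mean dimension: the inequality holds for every function, and the whole of [CXK K] is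
     taken. *)
  exists (CXK K); split; last by move=> f _; exact: leey.
  split => //; split.
    exists (fun=> CXK K); split; last by rewrite bigcap_const.
    by move=> j; split => // f cf; exists 1 => // g [].
  move=> f cf e e0; exists f => //; apply: le_lt_trans e0.
  by apply: sup_dist_le => // x; rewrite subrr normr0.
pose U j : set (X -> V) := [set f | CXK K f /\ low_entropy T f j.+1%:R^-1 (m + j.+1%:R^-1)].
have oU j f : CXK K f -> U j f -> exists2 r, 0 < r &
    forall g, CXK K g -> sup_dist f g < r -> U j g.
  move=> cf [_ gf]; have [r r0 hr] := low_entropy_open d0 Kd cf gf.
  by exists r => // g cg fg; split => //; exact: hr.
have dU j f e : CXK K f -> 0 < e -> exists g, [/\ CXK K g, U j g & sup_dist f g < e].
  move=> cf e0; have j0 : 0 < j.+1%:R^-1 :> R by rewrite invr_gt0.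
  have ma : (mean_dim T < (m + j.+1%:R^-1)%:E)%E by rewrite mE lte_fin ltrDl.
  have [g [cg gg fg]] := low_entropy_dense cX aT mT convK B0 KB ma cf e0 j0.
  by exists g.
exists (\bigcap_j U j); split; last first.
  move=> f Uf; have [cf _] := Uf 0%N Logic.I.
  by apply: (metric_mdim_le aT d0 Kd cf) => j; have [_] := Uf j Logic.I.
split; first by move=> f /(_ 0%N Logic.I)[].
split.
  exists U; split => // j; split; first by move=> f [].
  move=> f Uf; have [cf _] := Uf; have [r r0 hr] := oU j f cf Uf.
  by exists r => // g [cg fg]; exact: hr.
move=> f cf e e0; have [g [cg Ug fg]] := CXK_baire closedK Kd oU dU cf e0.
by exists g.
Qed.
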